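(* Let $X$ be a CBB$(0)$ space, let $Y$ be a complete CAT$(0)$ space and let $A \subseteq X$ be nonempty. Then there exists a continuous mapping $\beta_c : \mathcal{L}(A,Y) \to \mathcal{L}(X,Y)$ such that for all $g \in \mathcal{L}(A,Y)$, $\beta_c(g)(a) = g(a)$ for every $a \in A$, $\mathrm{Lip}(\beta_c(g),X) = \mathrm{Lip}(g,A)$ and $\beta_c(g)(X) \subseteq \overline{\mathrm{co}}(g(A))$.
   Context: A geodesic space is CAT$(0)$ (resp. CBB$(0)$) if for every geodesic triangle, distances between points on it are $\le$ (resp. $\ge$) distances between corresponding points of its Euclidean comparison triangle. $\mathcal{L}(A,Y)$ is the set of bounded Lipschitz maps $A\to Y$ with the supremum metric; $\mathrm{Lip}(f,B)$ is the smallest Lipschitz constant of $f$ on $B$. For $C\subseteq Y$, $G_1(C)$ is the union of all geodesic segments with endpoints in $C$, $G_n(C)=G_1(G_{n-1}(C))$, $\mathrm{co}(C)=\bigcup_n G_n(C)$, and $\overline{\mathrm{co}}(C)$ is its closure. *)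

(* Defs.v *)
From Stdlib Require Import Reals Lra.
From Coquelicot Require Import Coquelicot.
Open Scope R_scope.

Record MetricSpace := {
  mcarrier :> Type;
  dist : mcarrier -> mcarrier -> R;
  dist_eq0 : forall x y, dist x y = 0 <-> x = y;
  dist_sym : forall x y, dist x y = dist y x;
  dist_tri : forall x y z, dist x z <= dist x y + dist y z
}.
Arguments dist {m} _ _.

Definition is_geodesic {X : MetricSpace} (g : R -> X) (x y : X) : Prop :=
  g 0 = x /\ g 1 = y /\
  forall s t, 0 <= s <= 1 -> 0 <= t <= 1 ->
    dist (g s) (g t) = Rabs (s - t) * dist x y.

Definition geodesic_space (X : MetricSpace) : Prop :=
  forall x y : X, exists g : R -> X, is_geodesic g x y.

Definition edist (p q : R * R) : R :=
  sqrt ((fst p - fst q) ^ 2 + (snd p - snd q) ^ 2).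
Definition lerp (p q : R * R) (t : R) : R * R :=
  ((1 - t) * fst p + t * fst q, (1 - t) * snd p + t * snd q).

(** Points on the three sides of a geodesic triangle (side k = 0,1,2)
    and the corresponding points on the comparison triangle. *)
Definition tri_pt {X : MetricSpace} (g1 g2 g3 : R -> X) (k : nat) (t : R) : X :=
  match k with 0%nat => g1 t | 1%nat => g2 t | _ => g3 t end.
Definition cmp_pt (a b c : R * R) (k : nat) (t : R) : R * R :=
  match k with 0%nat => lerp a b t | 1%nat => lerp b c t | _ => lerp c a t end.

Definition comparison (rel : R -> R -> Prop) (X : MetricSpace) : Prop :=
  forall (x y z : X) (g1 g2 g3 : R -> X) (a b c : R * R),
    is_geodesic g1 x y -> is_geodesic g2 y z -> is_geodesic g3 z x ->
    edist a b = dist x y -> edist b c = dist y z -> edist c a = dist z x ->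
    forall (k l : nat) (s t : R), (k <= 2)%nat -> (l <= 2)%nat ->
      0 <= s <= 1 -> 0 <= t <= 1 ->
      rel (dist (tri_pt g1 g2 g3 k s) (tri_pt g1 g2 g3 l t))
          (edist (cmp_pt a b c k s) (cmp_pt a b c l t)).

Definition CAT0 (X : MetricSpace) : Prop :=
  geodesic_space X /\ comparison Rle X.
Definition CBB0 (X : MetricSpace) : Prop :=
  geodesic_space X /\ comparison Rge X.

Definition complete (X : MetricSpace) : Prop :=
  forall u : nat -> X,
    (forall eps, 0 < eps -> exists N, forall m n, (N <= m)%nat -> (N <= n)%nat ->
        dist (u m) (u n) < eps) ->
    exists l : X, forall eps, 0 < eps -> exists N, forall n, (N <= n)%nat ->
        dist (u n) l < eps.

Definition sub {X : MetricSpace} (A : X -> Prop) := {x : X | A x}.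

Definition bounded_map {S : Type} {Y : MetricSpace} (f : S -> Y) : Prop :=
  exists M, forall x y, dist (f x) (f y) <= M.

Definition lipschitz {S : Type} (dS : S -> S -> R) {Y : MetricSpace} (f : S -> Y) : Prop :=
  exists L, forall x y, dist (f x) (f y) <= L * dS x y.

Definition Lip {S : Type} (dS : S -> S -> R) {Y : MetricSpace} (f : S -> Y) : Rbar :=
  Glb_Rbar (fun L => 0 <= L /\ forall x y, dist (f x) (f y) <= L * dS x y).

Definition sub_dist {X : MetricSpace} (A : X -> Prop) (a b : sub A) : R :=
  dist (proj1_sig a) (proj1_sig b).

Definition inL {X Y : MetricSpace} (A : X -> Prop) (g : sub A -> Y) : Prop :=
  bounded_map g /\ lipschitz (sub_dist A) g.
Definition inLX {X Y : MetricSpace} (f : X -> Y) : Prop :=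
  bounded_map f /\ lipschitz (@dist X) f.

Definition supdist {S : Type} {Y : MetricSpace} (f g : S -> Y) : R :=
  real (Lub_Rbar (fun r => exists x, r = dist (f x) (g x))).

Definition G1 {Y : MetricSpace} (C : Y -> Prop) : Y -> Prop :=
  fun p => exists (x y : Y) (g : R -> Y) (t : R),
    C x /\ C y /\ is_geodesic g x y /\ 0 <= t <= 1 /\ p = g t.

Fixpoint Gn {Y : MetricSpace} (n : nat) (C : Y -> Prop) : Y -> Prop :=
  match n with 0%nat => C | S m => G1 (Gn m C) end.

Definition co {Y : MetricSpace} (C : Y -> Prop) : Y -> Prop :=
  fun p => exists n, (1 <= n)%nat /\ Gn n C p.

Definition closure {Y : MetricSpace} (C : Y -> Prop) : Y -> Prop :=
  fun p => forall eps, 0 < eps -> exists q, C q /\ dist p q < eps.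

Definition clco {Y : MetricSpace} (C : Y -> Prop) : Y -> Prop := closure (co C).

Definition image {S : Type} {Y : Type} (g : S -> Y) : Y -> Prop :=
  fun y => exists s, y = g s.

(* Main.v *)
From mathcomp Require filter.
Require Import Defs.
From Stdlib Require Import Reals.
From Coquelicot Require Import Coquelicot.
From Stdlib Require Import Lra Lia List Permutation Sorted Classical ClassicalEpsilon.
Require Import Defs.
Import ListNotations.
Open Scope R_scope.

(** A one-point Kirszbraun extension into a CAT(0) space only needs, at the new point
    [s], the Lang-Schroeder inequality [sum w_i w_j (Q s i + Q s j - Q i j) >= 0] for
    the prescribed squared distances [Q]. In a CBB(0) space the squared metric
    satisfies it, because directions can be added at [s] with upper bounds on inner
    products; and it is stable under adding to [Q] any metric, for instance a multiple
    of the supremum metric on maps. So all maps [g] with values in a fixed ball are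
    extended simultaneously, on pairs [(g, x)] with
    [Q (g, x) (h, y) = min (Lip g) (Lip h) ^ 2 * d (x, y) ^ 2 + 6 N * d_sup (g, h)].
    Because of the minimum, the inequality holds at [(g, x)] only against maps of smaller
    Lipschitz constant: finitely many pairs are treated in order of increasing Lipschitz
    constant, and asymptotic centres along an ultrafilter pass to all pairs. The
    extensions belonging to different balls are glued along geodesics, and finally
    projected onto the closed convex hull of [g (A)]. *)

(** * Comparison inequalities *)

(** Extending the maps one at a time involves choices that need not depend continuously on [g]. Once
    the pairs (g, x) are the points of a single extension problem, continuity in [g] is one more
    bound on squared distances, of the same kind as the Lipschitz condition. A squared distance that
    is linear in d_sup gives a modulus of order 1/2 only, which is why the later estimates assume
    d_sup (g, h) <= s ^ 2 and end with a multiple of s. The constant of that bound grows with the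
    size of the values, so they are first confined to a ball. Balls of [Y] need not be compact, and
    a one-point extension is found only up to an error eta. The error does not accumulate: slack eta
    between the old points yields the same slack at the new one, and the limit removes it. *)

Lemma dist_refl (X : MetricSpace) (x : X) : dist x x = 0.
Proof. now apply dist_eq0. Qed.

Lemma dist_pos (X : MetricSpace) (x y : X) : 0 <= dist x y.
Proof.
  assert (H := dist_tri X x y x). rewrite dist_refl, (dist_sym X y x) in H. lra.
Qed.

Lemma Rle_of_sqr (a b : R) : 0 <= b -> a ^ 2 <= b ^ 2 -> a <= b.
Proof. intros; nra. Qed.

Lemma geodesic_dist_l (X : MetricSpace) (g : R -> X) x y t :
  is_geodesic g x y -> 0 <= t <= 1 -> dist x (g t) = t * dist x y.
Proof.
  intros [H0 [_ H]] Ht. rewrite <- H0 at 1. rewrite H by lra.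
  rewrite Rabs_left1; lra.
Qed.

Lemma geodesic_dist_r (X : MetricSpace) (g : R -> X) x y t :
  is_geodesic g x y -> 0 <= t <= 1 -> dist (g t) y = (1 - t) * dist x y.
Proof.
  intros [_ [H1 H]] Ht. rewrite <- H1 at 1. rewrite H by lra.
  rewrite Rabs_left1; lra.
Qed.

Lemma sqrt_of_sqr (s a : R) : 0 <= a -> s = a ^ 2 -> sqrt s = a.
Proof. intros Ha ->. now apply sqrt_pow2. Qed.

Lemma comparison_triangle (A B C : R) :
  0 <= A -> 0 <= B -> 0 <= C -> A <= B + C -> B <= A + C -> C <= A + B ->
  exists a b c : R * R, edist a b = A /\ edist b c = B /\ edist c a = C.
Proof.
  intros HA HB HC H1 H2 H3. unfold edist.
  destruct (Req_dec A 0) as [->|HA0].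
  - exists (0, 0), (0, 0), (C, 0); cbn [fst snd].
    assert (B = C) as -> by lra.
    repeat split; apply sqrt_of_sqr; try assumption; ring.
  (* Law of cosines: [u] is the abscissa of the third vertex when the first side lies on the axis.
     The bounds on [u] below are the triangle inequalities. *)
  - set (u := (A ^ 2 + C ^ 2 - B ^ 2) / (2 * A)).
    assert (Hu : u * (2 * A) = A ^ 2 + C ^ 2 - B ^ 2) by (unfold u; field; lra).
    assert (Hv : 0 <= C ^ 2 - u ^ 2).
    { assert (u <= C).
      { apply Rmult_le_reg_r with (2 * A); [lra|]. rewrite Hu.
        assert (0 <= (B - A + C) * (B + A - C)) by (apply Rmult_le_pos; lra). nra. }
      assert (- C <= u).
      { apply Rmult_le_reg_r with (2 * A); [lra|]. rewrite Hu.
        assert (0 <= (A + C - B) * (A + C + B)) by (apply Rmult_le_pos; lra). nra. }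
      assert (0 <= (C - u) * (C + u)) by (apply Rmult_le_pos; lra). nra. }
    exists (0, 0), (A, 0), (u, sqrt (C ^ 2 - u ^ 2)); cbn [fst snd].
    assert (Hs := pow2_sqrt _ Hv).
    repeat split; apply sqrt_of_sqr; try assumption.
    + ring.
    + replace ((0 - sqrt (C ^ 2 - u ^ 2)) ^ 2) with (sqrt (C ^ 2 - u ^ 2) ^ 2) by ring.
      rewrite Hs. lra.
    + rewrite !Rminus_0_r, Hs. ring.
Qed.

(** Stewart's identity in the comparison triangle turns either comparison axiom into an inequality
    between squared distances. *)
Lemma comparison_vertex (rel : R -> R -> Prop) (X : MetricSpace) :
  geodesic_space X -> comparison rel X ->
  forall (x z y : X) (g : R -> X) (t : R), is_geodesic g x z -> 0 <= t <= 1 ->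
    exists e, 0 <= e /\
      e ^ 2 = (1 - t) * dist y x ^ 2 + t * dist y z ^ 2 - t * (1 - t) * dist x z ^ 2 /\
      rel (dist y (g t)) e.
Proof.
  intros HG HC x z y g t Hg Ht.
  destruct (HG z y) as [g2 Hg2]. destruct (HG y x) as [g3 Hg3].
  destruct (comparison_triangle (dist x z) (dist z y) (dist y x))
    as (a & b & c & Ha & Hb & Hc); try apply dist_pos.
  { assert (H := dist_tri X x y z). rewrite (dist_sym X x y), (dist_sym X y z) in H. lra. }
  { assert (H := dist_tri X z x y). rewrite (dist_sym X z x), (dist_sym X x y) in H. lra. }
  { assert (H := dist_tri X y z x). rewrite (dist_sym X y z), (dist_sym X z x) in H. lra. }
  assert (H := HC x z y g g2 g3 a b c Hg Hg2 Hg3 Ha Hb Hc 0%nat 1%nat t 1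
    ltac:(lia) ltac:(lia) Ht ltac:(lra)).
  cbn [tri_pt cmp_pt] in H.
  destruct Hg2 as (_ & Hg21 & _). rewrite Hg21 in H.
  exists (edist (lerp a b t) (lerp b c 1)).
  rewrite (dist_sym X y (g t)). split; [apply sqrt_pos|]. split; [|exact H].
  rewrite (dist_sym X y z), <- Ha, <- Hb, <- Hc.
  unfold edist, lerp; cbn [fst snd].
  rewrite !pow2_sqrt; [ring| | | |];
    apply Rplus_le_le_0_compat; apply pow2_ge_0.
Qed.

Lemma CAT0_CN (Y : MetricSpace) : CAT0 Y ->
  forall (x z y : Y) (g : R -> Y) (t : R), is_geodesic g x z -> 0 <= t <= 1 ->
    dist y (g t) ^ 2 <=
      (1 - t) * dist y x ^ 2 + t * dist y z ^ 2 - t * (1 - t) * dist x z ^ 2.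
Proof.
  intros [HG HC] x z y g t Hg Ht.
  destruct (comparison_vertex _ _ HG HC x z y g t Hg Ht) as (e & He & <- & H).
  assert (Hp := dist_pos _ y (g t)). nra.
Qed.

Lemma CBB0_CN (X : MetricSpace) : CBB0 X ->
  forall (x z y : X) (g : R -> X) (t : R), is_geodesic g x z -> 0 <= t <= 1 ->
    (1 - t) * dist y x ^ 2 + t * dist y z ^ 2 - t * (1 - t) * dist x z ^ 2
      <= dist y (g t) ^ 2.
Proof.
  intros [HG HC] x z y g t Hg Ht.
  destruct (comparison_vertex _ _ HG HC x z y g t Hg Ht) as (e & He & <- & H).
  assert (Hp := dist_pos _ y (g t)). nra.
Qed.

(** * The Lang-Schroeder inequality in CBB(0) spaces *)

Definition lsum {T : Type} (f : T -> R) (l : list T) : R :=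
  fold_right (fun x s => f x + s) 0 l.

Lemma lsum_le {T : Type} (f g : T -> R) (l : list T) :
  (forall x, In x l -> f x <= g x) -> lsum f l <= lsum g l.
Proof.
  induction l as [|x l IH]; simpl; intros H; [lra|].
  apply Rplus_le_compat; [apply H | apply IH]; auto.
Qed.

Lemma lsum_ext {T : Type} (f g : T -> R) (l : list T) :
  (forall x, In x l -> f x = g x) -> lsum f l = lsum g l.
Proof.
  intros H. apply Rle_antisym; apply lsum_le; intros x Hx; rewrite H; auto; lra.
Qed.

Lemma lsum_plus {T : Type} (f g : T -> R) (l : list T) :
  lsum (fun x => f x + g x) l = lsum f l + lsum g l.
Proof. induction l as [|x l IH]; simpl; [|rewrite IH]; ring. Qed.

Lemma lsum_scal {T : Type} (c : R) (f : T -> R) (l : list T) :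
  lsum (fun x => c * f x) l = c * lsum f l.
Proof. induction l as [|x l IH]; simpl; [|rewrite IH]; ring. Qed.

Lemma lsum_minus {T : Type} (f g : T -> R) (l : list T) :
  lsum (fun x => f x - g x) l = lsum f l - lsum g l.
Proof. induction l as [|x l IH]; simpl; [|rewrite IH]; ring. Qed.

Lemma lsum_const {T : Type} (c : R) (l : list T) :
  lsum (fun _ => c) l = INR (length l) * c.
Proof.
  induction l as [|x l IH]; [simpl; ring|].
  change (length (x :: l)) with (S (length l)). rewrite S_INR. simpl. rewrite IH. ring.
Qed.

Lemma lsum_nonneg {T : Type} (f : T -> R) (l : list T) :
  (forall x, In x l -> 0 <= f x) -> 0 <= lsum f l.
Proof.
  induction l as [|x l IH]; simpl; intros H; [lra|].
  apply Rplus_le_le_0_compat; [apply H | apply IH]; auto.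
Qed.

Lemma lsum_map {T U : Type} (h : U -> T) (f : T -> R) (l : list U) :
  lsum f (map h l) = lsum (fun x => f (h x)) l.
Proof. induction l as [|x l IH]; simpl; [|rewrite IH]; reflexivity. Qed.

Lemma lsum_Permutation {T : Type} (f : T -> R) (l l' : list T) :
  Permutation l l' -> lsum f l = lsum f l'.
Proof. induction 1; simpl; try lra. Qed.

Definition dsum {T : Type} (k : T -> T -> R) (l : list T) : R :=
  lsum (fun x => lsum (k x) l) l.

Lemma dsum_cons {T : Type} (k : T -> T -> R) (x : T) (l : list T) :
  (forall x y, k x y = k y x) ->
  dsum k (x :: l) = k x x + 2 * lsum (k x) l + dsum k l.
Proof.
  intros Hk. unfold dsum; simpl. rewrite lsum_plus.
  rewrite (lsum_ext (fun y => k y x) (k x)) by (intros; apply Hk). ring.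
Qed.

Lemma dsum_le {T : Type} (k k' : T -> T -> R) (l : list T) :
  (forall x y, In x l -> In y l -> k x y <= k' x y) -> dsum k l <= dsum k' l.
Proof. intros H. apply lsum_le; intros x Hx. apply lsum_le; auto. Qed.

Lemma dsum_map {T U : Type} (h : U -> T) (k : T -> T -> R) (l : list U) :
  dsum k (map h l) = dsum (fun x y => k (h x) (h y)) l.
Proof.
  unfold dsum. rewrite lsum_map. apply lsum_ext; intros. apply lsum_map.
Qed.

Lemma dsum_Permutation {T : Type} (k : T -> T -> R) (l l' : list T) :
  Permutation l l' -> dsum k l = dsum k l'.
Proof.
  intros H. unfold dsum. rewrite (lsum_Permutation _ _ _ H).
  apply lsum_ext; intros; now apply lsum_Permutation.
Qed.

(** * Directions at a point of a CBB(0) space *)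

Section LangSchroeder.

Context (X : MetricSpace) (HX : CBB0 X) (p : X).

(* Twice the Euclidean inner product read off a comparison triangle. *)
Definition ip (x y : X) : R := dist p x ^ 2 + dist p y ^ 2 - dist x y ^ 2.

Lemma ip_sym x y : ip x y = ip y x.
Proof. unfold ip. rewrite (dist_sym X x y). ring. Qed.

(** Angle monotonicity: shortening a side of a hinge at [p] can only widen its comparison angle.
    Limits at [p] therefore become infima. *)
Lemma ip_geodesic (g : R -> X) (x y : X) (s : R) :
  is_geodesic g p x -> 0 <= s <= 1 -> ip y (g s) <= s * ip y x.
Proof.
  intros Hg Hs. assert (H := CBB0_CN X HX p x y g s Hg Hs).
  unfold ip. rewrite (geodesic_dist_l _ _ _ _ _ Hg Hs).
  rewrite (dist_sym X y p) in H. nra.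
Qed.

(** A tangent vector at [p], represented by a geodesic on a short interval; [gspeed] is its norm and
    may be 0. *)
Record germ := {
  gfun :> R -> X;
  gspeed : R;
  glen : R;
  gspeed_pos : 0 <= gspeed;
  glen_pos : 0 < glen;
  gfun0 : gfun 0 = p;
  gfun_dist : forall s t, 0 <= s <= glen -> 0 <= t <= glen ->
    dist (gfun s) (gfun t) = gspeed * Rabs (s - t)
}.

Lemma germ_dist (a : germ) t : 0 <= t <= glen a -> dist p (a t) = gspeed a * t.
Proof.
  intros Ht. rewrite <- (gfun0 a). assert (H := glen_pos a).
  rewrite gfun_dist by lra. rewrite Rabs_left1; lra.
Qed.

Lemma germ_ip_scale (a : germ) (y : X) (s t : R) :
  0 <= s <= 1 -> 0 <= t <= glen a -> ip y (a (s * t)) <= s * ip y (a t).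
Proof.
  intros Hs Ht. apply (ip_geodesic (fun s => a (s * t))); [|exact Hs].
  split; [|split].
  - rewrite Rmult_0_l. apply gfun0.
  - now rewrite Rmult_1_l.
  - intros u v Hu Hv. rewrite gfun_dist by nra. rewrite germ_dist by lra.
    replace (u * t - v * t) with ((u - v) * t) by ring.
    rewrite Rabs_mult, (Rabs_pos_eq t) by lra. ring.
Qed.

(** By [germ_ip_scale] in both arguments the quotient decreases as [e] shrinks, so its infimum is
    the limit at 0: twice the inner product in the tangent cone. *)
Definition germ_ip_set (a b : germ) (r : R) : Prop :=
  exists e, 0 < e /\ e <= glen a /\ e <= glen b /\ r = ip (a e) (b e) / e ^ 2.

Definition germ_ip (a b : germ) : R := real (Glb_Rbar (germ_ip_set a b)).

Lemma germ_ip_sym a b : germ_ip a b = germ_ip b a.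
Proof.
  unfold germ_ip. f_equal. apply Glb_Rbar_eqset. intros r.
  split; intros (e & H1 & H2 & H3 & ->); exists e; rewrite ip_sym; auto.
Qed.

(** The triangle inequality through [p] bounds the quotients below by [- (2 * gspeed a * gspeed b)],
    so the infimum is finite and [real] loses nothing. *)
Lemma germ_ip_glb a b : is_glb_Rbar (germ_ip_set a b) (Finite (germ_ip a b)).
Proof.
  unfold germ_ip. assert (H := Glb_Rbar_correct (germ_ip_set a b)).
  destruct (Glb_Rbar (germ_ip_set a b)) as [r| |]; [exact H| |]; exfalso.
  - destruct H as [H _].
    assert (Ha := glen_pos a). assert (Hb := glen_pos b).
    specialize (H (ip (a (Rmin (glen a) (glen b))) (b (Rmin (glen a) (glen b)))
                   / Rmin (glen a) (glen b) ^ 2)). apply H.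
    exists (Rmin (glen a) (glen b)). repeat split.
    + now apply Rmin_pos.
    + apply Rmin_l.
    + apply Rmin_r.
  - destruct H as [_ H].
    specialize (H (Finite (- (2 * gspeed a * gspeed b)))). apply H.
    intros r (e & He & Hea & Heb & ->). cbn [Rbar_le].
    apply Rmult_le_reg_r with (e ^ 2); [nra|].
    replace (ip (a e) (b e) / e ^ 2 * e ^ 2) with (ip (a e) (b e)) by (field; lra).
    assert (Ht := dist_tri X (a e) p (b e)).
    assert (Hp := dist_pos X (a e) (b e)).
    unfold ip. rewrite (dist_sym X (a e) p) in Ht.
    rewrite (germ_dist a e), (germ_dist b e) in * by lra.
    assert (dist (a e) (b e) ^ 2 <= (gspeed a * e + gspeed b * e) ^ 2) by (apply pow_incr; lra).
    lra.
Qed.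

Lemma germ_ip_le a b e : 0 < e -> e <= glen a -> e <= glen b ->
  germ_ip a b * e ^ 2 <= ip (a e) (b e).
Proof.
  intros He Ha Hb. destruct (germ_ip_glb a b) as [H _].
  assert (H' := H (ip (a e) (b e) / e ^ 2)). cbn [Rbar_le] in H'.
  replace (ip (a e) (b e)) with (ip (a e) (b e) / e ^ 2 * e ^ 2)
    by (field; lra).
  apply Rmult_le_compat_r; [nra|]. apply H'. exists e. auto.
Qed.

Definition eventually0 (P : R -> Prop) : Prop :=
  exists d, 0 < d /\ forall e, 0 < e <= d -> P e.

Lemma eventually0_and P Q :
  eventually0 P -> eventually0 Q -> eventually0 (fun e => P e /\ Q e).
Proof.
  intros (d & Hd & HP) (d' & Hd' & HQ). exists (Rmin d d'). split.
  - now apply Rmin_pos.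
  - intros e He. assert (H1 := Rmin_l d d'). assert (H2 := Rmin_r d d').
    split; [apply HP | apply HQ]; lra.
Qed.

Lemma eventually0_list {T : Type} (P : T -> R -> Prop) (l : list T) :
  (forall x, eventually0 (P x)) -> eventually0 (fun e => forall x, In x l -> P x e).
Proof.
  intros H. induction l as [|x l IH].
  - exists 1. split; [lra|]. intros e _ x [].
  - destruct (eventually0_and _ _ (H x) IH) as (d & Hd & HP). exists d.
    split; [exact Hd|]. intros e He.
    destruct (HP e He) as [Hx Hl]. intros y [<-|Hy]; auto.
Qed.

(** By scaling, an almost optimal time stays so at all smaller times. The range [c <= 4] is there
    because [germ_sum] looks at the times [e], [2 * e] and [4 * e] together. *)
Lemma germ_ip_approx a b eta : 0 < eta ->
  eventually0 (fun e => 4 * e <= glen a /\ 4 * e <= glen b /\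
    forall c, 0 < c <= 4 -> ip (a (c * e)) (b (c * e)) <= (germ_ip a b + eta) * (c * e) ^ 2).
Proof.
  intros Heta. destruct (germ_ip_glb a b) as [_ H].
  assert (exists e, 0 < e /\ e <= glen a /\ e <= glen b /\
            ip (a e) (b e) / e ^ 2 <= germ_ip a b + eta) as (e & He & Ha & Hb & Hle).
  { apply NNPP. intros Hn.
    assert (H' := H (Finite (germ_ip a b + eta))). cbn [Rbar_le] in H'.
    enough (germ_ip a b + eta <= germ_ip a b) by lra. apply H'.
    intros r (e & H1 & H2 & H3 & ->). cbn [Rbar_le]. apply Rnot_lt_le. intros H4.
    apply Hn. exists e. repeat split; auto. lra. }
  exists (e / 4). split; [lra|]. intros e' He'. split; [lra|]. split; [lra|].
  intros c Hc. set (t := c * e'). assert (Ht : 0 < t <= e) by (unfold t; nra).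
  assert (H1 : ip (a t) (b t) <= (t / e) * ((t / e) * ip (a e) (b e))).
  { assert (Hte : 0 <= t / e <= 1).
    { split; [apply Rmult_le_pos; [lra|left; apply Rinv_0_lt_compat; lra]|].
      apply Rmult_le_reg_r with e; [lra|]. unfold Rdiv.
      rewrite Rmult_assoc, Rinv_l; lra. }
    replace t with (t / e * e) at 1 2 by (field; lra).
    eapply Rle_trans; [apply germ_ip_scale; [exact Hte|lra]|].
    apply Rmult_le_compat_l; [lra|]. rewrite ip_sym, (ip_sym (a e)).
    apply germ_ip_scale; [exact Hte|lra]. }
  replace (t / e * (t / e * ip (a e) (b e))) with (ip (a e) (b e) / e ^ 2 * t ^ 2) in H1
    by (field; lra).
  eapply Rle_trans; [exact H1|]. apply Rmult_le_compat_r; [nra|exact Hle].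
Qed.

Lemma germ_ip_diag a : germ_ip a a = 2 * gspeed a ^ 2.
Proof.
  unfold germ_ip. rewrite (is_glb_Rbar_unique _ (Finite (2 * gspeed a ^ 2))); [reflexivity|].
  assert (Hval : forall e, 0 < e <= glen a -> ip (a e) (a e) / e ^ 2 = 2 * gspeed a ^ 2).
  { intros e He. unfold ip. rewrite dist_refl, germ_dist by lra. field. lra. }
  split.
  - intros r (e & H1 & H2 & _ & ->). cbn [Rbar_le]. rewrite Hval by lra. lra.
  - intros r Hr. apply (Hr (2 * gspeed a ^ 2)). exists (glen a).
    assert (H := glen_pos a). repeat split; try lra. rewrite Hval by lra. reflexivity.
Qed.

Lemma germ_of_geodesic (g : R -> X) (x : X) (e : R) : 0 < e -> is_geodesic g p x ->
  exists v : germ, v e = x /\ glen v = e /\ gspeed v = dist p x / e.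
Proof.
  intros He (H0 & H1 & H).
  assert (Hr : forall s, 0 <= s <= e -> 0 <= s / e <= 1).
  { intros s Hs. split; [apply Rmult_le_pos; [lra|left; apply Rinv_0_lt_compat; lra]|].
    apply Rmult_le_reg_r with e; [lra|]. unfold Rdiv. rewrite Rmult_assoc, Rinv_l; lra. }
  assert (Hsp : 0 <= dist p x / e).
  { apply Rmult_le_pos; [apply dist_pos|left; apply Rinv_0_lt_compat; lra]. }
  assert (Hd : forall s t, 0 <= s <= e -> 0 <= t <= e ->
            dist (g (s / e)) (g (t / e)) = dist p x / e * Rabs (s - t)).
  { intros s t Hs Ht. rewrite H by (now apply Hr).
    replace (s / e - t / e) with ((s - t) * / e) by (field; lra).
    rewrite Rabs_mult, (Rabs_pos_eq (/ e)); [unfold Rdiv; ring|].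
    left; apply Rinv_0_lt_compat; lra. }
  assert (Hz : g (0 / e) = p) by (unfold Rdiv; now rewrite Rmult_0_l).
  exists (Build_germ (fun t => g (t / e)) _ _ Hsp He Hz Hd). simpl.
  repeat split. unfold Rdiv. rewrite Rinv_r by lra. exact H1.
Qed.

(* The germ pointing at the midpoint of [a(2e)] and [b(2e)] plays the role of the
   sum of the two directions in the tangent cone at [p]; only upper bounds on its
   inner products are available, and they are what the induction needs. *)
Lemma germ_sum (a b : germ) (l : list germ) (eta : R) : 0 < eta ->
  exists v : germ,
    germ_ip v v <= germ_ip a a + 2 * germ_ip a b + germ_ip b b + 8 * eta /\
    forall c, In c l -> germ_ip v c <= germ_ip a c + germ_ip b c + 6 * eta.
Proof.
  intros Heta.
  destruct (eventually0_and _ _ (germ_ip_approx a b eta Heta)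
    (eventually0_and _ _
      (eventually0_list (fun c e => _) l (fun c => germ_ip_approx c a eta Heta))
      (eventually0_list (fun c e => _) l (fun c => germ_ip_approx c b eta Heta))))
    as (e & He & Hev).
  destruct (Hev e ltac:(lra)) as ((Hla & Hlb & Hab) & Hca & Hcb). clear Hev.
  set (A := a (2 * e)). set (B := b (2 * e)). set (A' := a (4 * e)).
  destruct (proj1 HX A B) as [g Hg]. set (m := g (1 / 2)).
  assert (CNm : forall y, 1 / 2 * dist y A ^ 2 + 1 / 2 * dist y B ^ 2 - 1 / 4 * dist A B ^ 2
            <= dist y m ^ 2).
  { intros y. assert (H := CBB0_CN X HX A B y g (1 / 2) Hg ltac:(lra)). fold m in H. lra. }
  assert (HmA : dist A m = 1 / 2 * dist A B) by (apply geodesic_dist_l; [exact Hg|lra]).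
  assert (HpA : dist p A = gspeed a * (2 * e)) by (apply germ_dist; lra).
  assert (HpB : dist p B = gspeed b * (2 * e)) by (apply germ_dist; lra).
  assert (HpA' : dist p A' = gspeed a * (4 * e)) by (apply germ_dist; lra).
  assert (HAA' : dist A' A = gspeed a * (2 * e)).
  { unfold A, A'. rewrite gfun_dist by lra. rewrite Rabs_pos_eq; lra. }
  (* Comparison in [X] bounds distances from below only. The upper bound on [dist p m] comes from
     [A] being the midpoint of [p] and [A']: seen from [m], the distance to [A] is half of
     [dist A B], and the distance to [A'] is bounded below. *)
  assert (HAm : 1 / 2 * dist m p ^ 2 + 1 / 2 * dist m A' ^ 2 - 1 / 4 * dist p A' ^ 2
            <= dist m A ^ 2).
  { assert (H := germ_ip_scale a m (1 / 2) (4 * e) ltac:(lra) ltac:(lra)).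
    replace (1 / 2 * (4 * e)) with (2 * e) in H by lra. fold A A' in H.
    unfold ip in H. rewrite (dist_sym X m p). rewrite HpA, HpA' in *. lra. }
  assert (HBA' : ip B A' <= 8 * (germ_ip a b + eta) * e ^ 2).
  { rewrite ip_sym.
    assert (H := germ_ip_scale b A' (1 / 2) (4 * e) ltac:(lra) ltac:(lra)).
    replace (1 / 2 * (4 * e)) with (2 * e) in H by lra. fold B in H.
    specialize (Hab 4 ltac:(lra)). fold A' in Hab. lra. }
  assert (HAB : germ_ip a b * (2 * e) ^ 2 <= ip A B) by (apply germ_ip_le; lra).
  assert (HmA' := CNm A'). unfold ip in HBA', HAB.
  rewrite (dist_sym X A' B), HAA', (dist_sym X A' m) in HmA'.
  rewrite (dist_sym X A m) in HmA. rewrite HmA, HpA', (dist_sym X m p) in HAm.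
  rewrite HpA, HpB, HpA' in *.
  assert (Hm : dist p m ^ 2
            <= e ^ 2 * (gspeed a ^ 2 + gspeed b ^ 2 + germ_ip a b + 4 * eta)) by lra.
  destruct (proj1 HX p m) as [h Hh].
  destruct (germ_of_geodesic h m e ltac:(lra) Hh) as (v & Hve & Hvl & Hvs).
  exists v. split.
  - rewrite !germ_ip_diag, Hvs.
    apply Rmult_le_reg_r with (e ^ 2); [nra|].
    replace (2 * (dist p m / e) ^ 2 * e ^ 2) with (2 * dist p m ^ 2) by (field; lra). lra.
  - intros c Hc. destruct (Hca c Hc) as (Hlc & _ & Hca'). destruct (Hcb c Hc) as (_ & _ & Hcb').
    clear Hca Hcb. set (y := c e).
    assert (Hvc : germ_ip v c * e ^ 2 <= ip (v e) y) by (apply germ_ip_le; lra).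
    assert (HyA : ip y A <= 2 * (germ_ip a c + eta) * e ^ 2).
    { rewrite ip_sym.
      assert (H := germ_ip_scale c A (1 / 2) (2 * e) ltac:(lra) ltac:(lra)).
      replace (1 / 2 * (2 * e)) with e in H by lra.
      specialize (Hca' 2 ltac:(lra)). fold A in Hca'. rewrite ip_sym in Hca'.
      rewrite (germ_ip_sym a c). unfold y. lra. }
    assert (HyB : ip y B <= 2 * (germ_ip b c + eta) * e ^ 2).
    { rewrite ip_sym.
      assert (H := germ_ip_scale c B (1 / 2) (2 * e) ltac:(lra) ltac:(lra)).
      replace (1 / 2 * (2 * e)) with e in H by lra.
      specialize (Hcb' 2 ltac:(lra)). fold B in Hcb'. rewrite ip_sym in Hcb'.
      rewrite (germ_ip_sym b c). unfold y. lra. }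
    specialize (CNm y). rewrite Hve in Hvc.
    unfold ip in Hvc, HyA, HyB. rewrite (dist_sym X m y) in Hvc.
    rewrite HpA in HyA. rewrite HpB in HyB.
    apply Rmult_le_reg_r with (e ^ 2); [nra|]. lra.
Qed.

(** Replacing two germs by their sum shortens the list and increases the double sum by an
    arbitrarily small amount at most. *)
Lemma germ_dsum_nonneg (n : nat) :
  forall l : list germ, length l = n -> 0 <= dsum germ_ip l.
Proof.
  induction n as [|n IH]; intros [|a [|b l]] Hl; try discriminate.
  - unfold dsum; simpl; lra.
  - rewrite (dsum_cons _ _ _ germ_ip_sym), germ_ip_diag. unfold dsum; simpl. nra.
  - apply le_epsilon. intros eta Heta.
    (* [germ_sum] loses 8 on the diagonal term and 6 on each cross term, which occurs twice. *)
    set (c := 8 + 12 * INR (length l)).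
    assert (Hc : 0 < c) by (unfold c; assert (H := pos_INR (length l)); lra).
    destruct (germ_sum a b l (eta / c)) as (v & Hvv & Hvl).
    { apply Rmult_lt_0_compat; [lra|now apply Rinv_0_lt_compat]. }
    assert (Hpos := IH (v :: l) ltac:(simpl in *; lia)).
    rewrite !(dsum_cons _ _ _ germ_ip_sym) in *. simpl.
    assert (Hs := lsum_le _ _ l Hvl).
    rewrite 2!lsum_plus in Hs.
    rewrite lsum_const in Hs.
    assert (Hce : c * (eta / c) = eta) by (field; lra). unfold c at 1 in Hce. lra.
Qed.

(** Weights become speeds: the germ of [(w, x)] follows a geodesic towards [x] with parameter
    multiplied by [w]. Angle monotonicity in both arguments bounds the inner products of germs by
    the weighted [ip]. *)
Lemma lang_schroeder (l : list (R * X)) :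
  (forall q, In q l -> 0 <= fst q) ->
  0 <= dsum (fun q r => fst q * fst r * ip (snd q) (snd r)) l.
Proof.
  intros Hw.
  assert (Hg : exists f : R * X -> germ, forall q, In q l -> forall r, In r l ->
            germ_ip (f q) (f r) <= fst q * fst r * ip (snd q) (snd r)).
  { assert (Hq : forall q : R * X, exists a : germ, 0 <= fst q ->
              exists g, is_geodesic g p (snd q) /\ forall t, a t = g (fst q * t)).
    { intros [w x]; simpl. destruct (proj1 HX p x) as [g Hg].
      (* This length keeps [Rabs w * s] in [0, 1]; the absolute value provides a germ for every [w],
         so that the choice function is total. *)
      assert (Hl : 0 < / (1 + Rabs w)).
      { apply Rinv_0_lt_compat. assert (H := Rabs_pos w). lra. }
      assert (Hsp : 0 <= Rabs w * dist p x).
      { apply Rmult_le_pos; [apply Rabs_pos|apply dist_pos]. }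
      assert (Hr : forall s, 0 <= s <= / (1 + Rabs w) -> 0 <= Rabs w * s <= 1).
      { intros s Hs. assert (H := Rabs_pos w). split; [nra|].
        assert (H1 : (1 + Rabs w) * / (1 + Rabs w) = 1) by (apply Rinv_r; lra). nra. }
      assert (Hz : g (Rabs w * 0) = p) by (rewrite Rmult_0_r; apply Hg).
      assert (Hd : forall s t, 0 <= s <= / (1 + Rabs w) -> 0 <= t <= / (1 + Rabs w) ->
                dist (g (Rabs w * s)) (g (Rabs w * t)) = Rabs w * dist p x * Rabs (s - t)).
      { intros s t Hs Ht. destruct Hg as (_ & _ & Hg). rewrite Hg by auto.
        rewrite <- Rmult_minus_distr_l, Rabs_mult, Rabs_Rabsolu. ring. }
      exists (Build_germ (fun t => g (Rabs w * t)) _ _ Hsp Hl Hz Hd). simpl.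
      intros Hw0. exists g. split; [exact Hg|]. intros t. now rewrite Rabs_pos_eq. }
    exists (fun q => proj1_sig (constructive_indefinite_description _ (Hq q))).
    intros q Hql r Hrl.
    destruct (constructive_indefinite_description _ (Hq q)) as [a Ha].
    destruct (constructive_indefinite_description _ (Hq r)) as [b Hb]. simpl.
    assert (Hwq := Hw q Hql). assert (Hwr := Hw r Hrl).
    destruct (Ha Hwq) as (g & Hg & Hag). destruct (Hb Hwr) as (h & Hh & Hbh).
    set (e := Rmin (Rmin (glen a) (glen b)) (/ (1 + fst q + fst r))).
    assert (He : 0 < e).
    { apply Rmin_pos; [apply Rmin_pos; apply glen_pos|]. apply Rinv_0_lt_compat; lra. }
    assert (He1 : e <= glen a) by (eapply Rle_trans; [apply Rmin_l|apply Rmin_l]).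
    assert (He2 : e <= glen b) by (eapply Rle_trans; [apply Rmin_l|apply Rmin_r]).
    assert (He3 : e * (1 + fst q + fst r) <= 1).
    { apply Rle_trans with (/ (1 + fst q + fst r) * (1 + fst q + fst r)).
      - apply Rmult_le_compat_r; [lra|apply Rmin_r].
      - rewrite Rinv_l; lra. }
    apply Rmult_le_reg_r with (e ^ 2); [nra|].
    eapply Rle_trans; [apply germ_ip_le; assumption|].
    rewrite Hag, Hbh.
    eapply Rle_trans; [apply (ip_geodesic h _ _ _ Hh); nra|].
    rewrite ip_sym.
    eapply Rle_trans; [apply Rmult_le_compat_l; [nra|apply (ip_geodesic g _ _ _ Hg); nra]|].
    rewrite ip_sym. lra. }
  destruct Hg as [f Hf].
  eapply Rle_trans; [apply (germ_dsum_nonneg _ (map f l) eq_refl)|].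
  rewrite dsum_map. now apply dsum_le; auto.
Qed.

End LangSchroeder.

(** * The inequality with varying Lipschitz constants *)

Lemma list_min {T : Type} (c : T -> R) (l : list T) : l <> [] ->
  exists k l', Permutation l (k :: l') /\ forall r, In r l' -> c k <= c r.
Proof.
  induction l as [|x l IH]; [congruence|]. intros _.
  destruct l as [|y l].
  - exists x, []. split; [apply Permutation_refl|]. intros r [].
  - destruct IH as (k & l' & Hp & Hk); [discriminate|].
    destruct (Rle_dec (c x) (c k)) as [Hle|Hgt].
    + exists x, (y :: l). split; [apply Permutation_refl|]. intros r Hr.
      apply (Permutation_in _ Hp) in Hr. destruct Hr as [<-|Hr]; [exact Hle|].
      specialize (Hk r Hr). lra.
    + exists k, (x :: l'). split.
      * eapply perm_trans; [apply perm_skip, Hp|apply perm_swap].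
      * intros r [<-|Hr]; [lra|auto].
Qed.

(* Summation by parts in the level of [c]: removing the element of least level
   reduces to the case of constant [c]. *)
Lemma lang_schroeder_min {T : Type} (a c : T -> R) (d : T -> T -> R) :
  (forall x, 0 <= a x) -> (forall x, 0 <= c x) -> (forall x y, d x y = d y x) ->
  (forall l : list (R * T), (forall q, In q l -> 0 <= fst q) ->
    0 <= dsum (fun q r => fst q * fst r * (a (snd q) + a (snd r) - d (snd q) (snd r))) l) ->
  forall l : list (R * T), (forall q, In q l -> 0 <= fst q) ->
    0 <= dsum (fun q r => fst q * fst r *
           (c (snd q) * a (snd q) + c (snd r) * a (snd r)
            - Rmin (c (snd q)) (c (snd r)) * d (snd q) (snd r))) l.
Proof.
  intros Ha Hc Hd LS.
  set (k1 := fun q r : R * T => fst q * fst r * (a (snd q) + a (snd r) - d (snd q) (snd r))) in *.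
  set (k2 := fun q r : R * T => fst q * fst r *
           (c (snd q) * a (snd q) + c (snd r) * a (snd r)
            - Rmin (c (snd q)) (c (snd r)) * d (snd q) (snd r))).
  assert (K1 : forall q r, k1 q r = k1 r q) by (intros; unfold k1; rewrite Hd; ring).
  assert (K2 : forall q r, k2 q r = k2 r q)
    by (intros; unfold k2; rewrite Hd, Rmin_comm; ring).
  (* The lower bound [m] on the levels drives the induction: [LS] allows raising it to the least
     level before the element of that level is split off. *)
  assert (main : forall n l, length l = n -> (forall q, In q l -> 0 <= fst q) ->
    forall m, 0 <= m -> (forall q, In q l -> m <= c (snd q)) -> m * dsum k1 l <= dsum k2 l).
  { induction n as [|n IH]; intros l Hn Hw m Hm Hml.
    - destruct l; [unfold dsum; simpl; lra|discriminate].
    - destruct (list_min (fun q => c (snd q)) l) as (k & l' & Hp & Hk);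
        [intros ->; discriminate|].
      assert (Hw' : forall q, In q (k :: l') -> 0 <= fst q)
        by (intros q Hq; apply Hw; now apply (Permutation_in _ (Permutation_sym Hp))).
      assert (Hmk : m <= c (snd k))
        by (apply Hml, (Permutation_in _ (Permutation_sym Hp)); now left).
      rewrite (dsum_Permutation k1 _ _ Hp), (dsum_Permutation k2 _ _ Hp).
      apply Rle_trans with (c (snd k) * dsum k1 (k :: l')).
      { apply Rmult_le_compat_r; [apply LS|]; auto. }
      rewrite !dsum_cons by assumption.
      assert (H1 := IH l' ltac:(apply Permutation_length in Hp; simpl in Hp; lia)
        ltac:(intros; apply Hw'; now right) (c (snd k)) (Hc _) Hk).
      assert (H2 : c (snd k) * lsum (k1 k) l' <= lsum (k2 k) l').
      { rewrite <- lsum_scal. apply lsum_le. intros r Hr. unfold k1, k2.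
        rewrite Rmin_left by now apply Hk.
        assert (Hkr := Hk r Hr). assert (H3 := Hw' k (or_introl eq_refl)).
        assert (H4 := Hw' r (or_intror Hr)). assert (H5 := Ha (snd r)).
        assert (0 <= fst k * fst r * ((c (snd r) - c (snd k)) * a (snd r))).
        { repeat apply Rmult_le_pos; try assumption; lra. }
        lra. }
      assert (H3 : k2 k k = c (snd k) * k1 k k).
      { unfold k1, k2. rewrite Rmin_left by lra. ring. }
      lra. }
  intros l Hw. specialize (main _ l eq_refl Hw 0 (Rle_refl 0) (fun q _ => Hc _)). lra.
Qed.

(** * Convexity and projections in complete CAT(0) spaces *)

Definition closed_set {Y : MetricSpace} (C : Y -> Prop) : Prop :=
  forall p, closure C p -> C p.

Definition geoconvex {Y : MetricSpace} (C : Y -> Prop) : Prop :=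
  forall x z g t, C x -> C z -> is_geodesic g x z -> 0 <= t <= 1 -> C (g t).

(** Normalised so that the squared distance to a point of a CAT(0) space is an instance; the gain at
    a minimiser is then exactly [dist b z ^ 2]. *)
Definition strongly_convex {Y : MetricSpace} (phi : Y -> R) : Prop :=
  forall x z g t, is_geodesic g x z -> 0 <= t <= 1 ->
    phi (g t) <= (1 - t) * phi x + t * phi z - t * (1 - t) * dist x z ^ 2.

Definition lower_semicontinuous {Y : MetricSpace} (phi : Y -> R) : Prop :=
  forall y eps, 0 < eps ->
    exists delta, 0 < delta /\ forall z, dist y z < delta -> phi y <= phi z + eps.

Section CompleteCAT0.

Context (Y : MetricSpace) (HY : CAT0 Y) (HYc : complete Y).

(** Strong convexity at midpoints makes minimising sequences Cauchy. The quadratic gain comes from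
    the geodesic joining the minimiser to [z], after division by [t] and with [t] tending to 0. *)
Lemma strongly_convex_minimizer (C : Y -> Prop) (phi : Y -> R) (B : R) :
  (exists y, C y) -> closed_set C -> geoconvex C ->
  strongly_convex phi -> lower_semicontinuous phi -> (forall y, C y -> B <= phi y) ->
  exists b, C b /\ forall z, C z -> phi b + dist b z ^ 2 <= phi z.
Proof.
  intros [y0 Hy0] HCc HCg Hphi Hlsc HB.
  destruct (completeness (fun r => exists y, C y /\ r = - phi y)) as [M [HM1 HM2]].
  { exists (- B). intros r (y & Hy & ->). specialize (HB y Hy). lra. }
  { exists (- phi y0), y0. auto. }
  set (m := - M).
  assert (Hm : forall y, C y -> m <= phi y).
  { intros y Hy. specialize (HM1 (- phi y) ltac:(exists y; auto)). unfold m. lra. }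
  assert (Hinf : forall n : nat, exists y, C y /\ phi y < m + / (INR n + 1)).
  { intros n. apply NNPP. intros Hn.
    assert (Hp : 0 < / (INR n + 1)) by (apply Rinv_0_lt_compat; assert (H := pos_INR n); lra).
    enough (M <= M - / (INR n + 1)) by lra. apply HM2.
    intros r (y & Hy & ->). apply Rnot_lt_le. intros H. apply Hn. exists y.
    split; [exact Hy|]. unfold m. lra. }
  destruct (choice _ Hinf) as [u Hu].
  assert (Hd : forall i j, dist (u i) (u j) ^ 2 <= 2 * (/ (INR i + 1) + / (INR j + 1))).
  { intros i j. destruct (Hu i) as [Hi1 Hi2]. destruct (Hu j) as [Hj1 Hj2].
    destruct (proj1 HY (u i) (u j)) as [g Hg].
    assert (H1 := Hphi _ _ g (1 / 2) Hg ltac:(lra)).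
    assert (H2 := Hm _ (HCg _ _ g (1 / 2) Hi1 Hj1 Hg ltac:(lra))). lra. }
  destruct (HYc u) as [b Hb].
  { intros eps Heps. destruct (archimed_cor1 (eps ^ 2 / 4)) as (N & HN & HN0); [nra|].
    exists N. intros i j Hi Hj.
    assert (Hin : forall k, (N <= k)%nat -> / (INR k + 1) < eps ^ 2 / 4).
    { intros k Hk. eapply Rle_lt_trans; [|exact HN].
      apply Rinv_le_contravar; [now apply lt_0_INR|]. apply le_INR in Hk. lra. }
    specialize (Hd i j). assert (H1 := Hin i Hi). assert (H2 := Hin j Hj).
    assert (H3 := dist_pos Y (u i) (u j)). nra. }
  assert (HbC : C b).
  { apply HCc. intros eps Heps. destruct (Hb eps Heps) as [N HN]. exists (u N).
    split; [apply Hu|]. rewrite dist_sym. now apply HN. }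
  assert (Hbm : phi b <= m).
  { apply le_epsilon. intros eps Heps.
    destruct (Hlsc b (eps / 2)) as (delta & Hdelta & HL); [lra|].
    destruct (Hb delta Hdelta) as [N HN].
    destruct (archimed_cor1 (eps / 2)) as (K & HK & HK0); [lra|].
    specialize (HN (Nat.max N K) ltac:(lia)). rewrite dist_sym in HN.
    specialize (HL _ HN). destruct (Hu (Nat.max N K)) as [_ HuN].
    assert (/ (INR (Nat.max N K) + 1) < eps / 2).
    { eapply Rle_lt_trans; [|exact HK].
      apply Rinv_le_contravar; [now apply lt_0_INR|].
      assert (H := le_INR K (Nat.max N K) ltac:(lia)). lra. }
    lra. }
  exists b. split; [exact HbC|]. intros z Hz.
  destruct (proj1 HY b z) as [g Hg].
  assert (Ht : forall t, 0 < t <= 1 -> m <= phi z - (1 - t) * dist b z ^ 2).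
  { intros t Ht. assert (H1 := Hphi _ _ g t Hg ltac:(lra)).
    assert (H2 := Hm _ (HCg _ _ g t HbC Hz Hg ltac:(lra))).
    apply Rmult_le_reg_l with t; [lra|]. nra. }
  apply Rle_trans with (m + dist b z ^ 2); [lra|].
  apply le_epsilon. intros eps Heps.
  set (t := eps / (eps + dist b z ^ 2 + 1)).
  assert (Hp : 0 <= dist b z ^ 2) by apply pow2_ge_0.
  assert (Hte : t * (eps + dist b z ^ 2 + 1) = eps) by (unfold t; field; lra).
  assert (Ht0 : 0 < t).
  { apply Rmult_lt_0_compat; [lra|]. apply Rinv_0_lt_compat. lra. }
  specialize (Ht t ltac:(nra)). nra.
Qed.

(** Reshetnyak's inequality, the Cauchy-Schwarz inequality for the pairs [(b, b')] and [(y, y')]. *)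
Lemma quadrilateral (b b' y y' : Y) :
  dist b' y ^ 2 + dist b y' ^ 2
    <= dist b y ^ 2 + dist b' y' ^ 2 + 2 * dist b b' * dist y y'.
Proof.
  assert (Hu := dist_pos Y b b'). assert (Hv := dist_pos Y y y').
  destruct Hu as [Hu|Hu].
  2: { rewrite <- Hu. symmetry in Hu. apply dist_eq0 in Hu. subst b'. lra. }
  destruct Hv as [Hv|Hv].
  2: { rewrite <- Hv. symmetry in Hv. apply dist_eq0 in Hv. subst y'. lra. }
  set (u := dist b b') in *. set (v := dist y y') in *.
  destruct (proj1 HY b' y) as [g Hg].
  (* The diagonal from [b'] to [y] is cut in the ratio of the sides [u] and [v]: the terms in
     [u ^ 2] and [v ^ 2] then both become [s * (1 - s) * (u * v)]. *)
  set (s := u / (u + v)).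
  assert (Hs : s * (u + v) = u) by (unfold s; field; lra).
  assert (Hs01 : 0 < s < 1).
  { split; [apply Rmult_lt_0_compat; [lra|apply Rinv_0_lt_compat; lra]|nra]. }
  assert (H1 := CAT0_CN Y HY _ _ b g s Hg ltac:(lra)).
  assert (H2 := CAT0_CN Y HY _ _ y' g s Hg ltac:(lra)).
  assert (H3 := dist_tri Y b (g s) y'). rewrite (dist_sym Y (g s) y') in H3.
  rewrite (dist_sym Y y' b'), (dist_sym Y y' y) in H2.
  fold u in H1. fold v in H2.
  set (al := dist b (g s)) in *. set (be := dist y' (g s)) in *.
  set (P := dist b' y) in *.
  assert (H4 : dist b y' ^ 2 <= (al + be) ^ 2) by (apply pow_incr; split; [apply dist_pos|exact H3]).
  assert (H5 : s * (1 - s) * (al + be) ^ 2 <= (1 - s) * al ^ 2 + s * be ^ 2).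
  { assert (0 <= ((1 - s) * al - s * be) ^ 2) by apply pow2_ge_0. lra. }
  assert (H6 : s * (1 - s) * dist b y' ^ 2 <= s * (1 - s) * (al + be) ^ 2).
  { apply Rmult_le_compat_l; nra. }
  assert (H7 : (1 - s) * al ^ 2 <= (1 - s) * ((1 - s) * u ^ 2 + s * dist b y ^ 2 - s * (1 - s) * P ^ 2))
    by (apply Rmult_le_compat_l; lra).
  assert (H8 : s * be ^ 2 <= s * ((1 - s) * dist b' y' ^ 2 + s * v ^ 2 - s * (1 - s) * P ^ 2))
    by (apply Rmult_le_compat_l; lra).
  assert (H9 : (1 - s) * u = s * v) by lra.
  assert (H10 : (1 - s) * (1 - s) * u ^ 2 = s * (1 - s) * (u * v)).
  { replace ((1 - s) * (1 - s) * u ^ 2) with ((1 - s) * u * ((1 - s) * u)) by ring.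
    rewrite H9 at 1. ring. }
  assert (H11 : s * s * v ^ 2 = s * (1 - s) * (u * v)).
  { replace (s * s * v ^ 2) with (s * v * (s * v)) by ring. rewrite <- H9 at 1. ring. }
  apply Rmult_le_reg_l with (s * (1 - s)); [nra|]. lra.
Qed.

Lemma dist_sqr_convex (y : Y) : strongly_convex (fun z => dist y z ^ 2).
Proof. intros x z g t Hg Ht. now apply CAT0_CN. Qed.

Lemma dist_sqr_lsc (y : Y) : lower_semicontinuous (fun z => dist y z ^ 2).
Proof.
  intros x eps Heps. exists (eps / (2 * dist y x + 1)).
  assert (Hp := dist_pos Y y x).
  split. { apply Rmult_lt_0_compat; [lra|]. apply Rinv_0_lt_compat. lra. }
  intros z Hz.
  assert (Hd : eps / (2 * dist y x + 1) * (2 * dist y x + 1) = eps) by (field; lra).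
  set (e := eps / (2 * dist y x + 1)) in *.
  assert (Ht := dist_tri Y y z x). rewrite (dist_sym Y z x) in Ht.
  assert (Hz0 := dist_pos Y x z). assert (Hyz := dist_pos Y y z).
  destruct (Rle_dec (dist y x) (dist y z)); nra.
Qed.

Lemma projection_exists (C : Y -> Prop) :
  (exists y, C y) -> closed_set C -> geoconvex C ->
  exists P : Y -> Y, forall x, C (P x) /\
    forall z, C z -> dist x (P x) ^ 2 + dist (P x) z ^ 2 <= dist x z ^ 2.
Proof.
  intros H1 H2 H3.
  apply (choice (fun x y => C y /\
    forall z, C z -> dist x y ^ 2 + dist y z ^ 2 <= dist x z ^ 2)). intros x.
  apply (strongly_convex_minimizer C (fun z => dist x z ^ 2) 0); auto.
  - apply dist_sqr_convex.
  - apply dist_sqr_lsc.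
  - intros y _. apply pow2_ge_0.
Qed.

(** The obtuse angle inequality at each projection, tested at the other one, combines with the
    quadrilateral inequality. *)
Lemma projection_nonexpansive (C : Y -> Prop) (P : Y -> Y) :
  (forall x, C (P x) /\
    forall z, C z -> dist x (P x) ^ 2 + dist (P x) z ^ 2 <= dist x z ^ 2) ->
  forall x y, dist (P x) (P y) <= dist x y.
Proof.
  intros HP x y. destruct (HP x) as [Hx1 Hx2]. destruct (HP y) as [Hy1 Hy2].
  specialize (Hx2 _ Hy1). specialize (Hy2 _ Hx1).
  assert (H := quadrilateral (P x) (P y) x y).
  rewrite (dist_sym Y (P y) x), (dist_sym Y (P x) y), (dist_sym Y (P x) x),
    (dist_sym Y (P y) y) in H.
  rewrite (dist_sym Y (P y) (P x)) in Hy2.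
  assert (H1 := dist_pos Y (P x) (P y)). assert (H2 := dist_pos Y x y). nra.
Qed.

Lemma geodesic_rev (g : R -> Y) x y :
  is_geodesic g x y -> is_geodesic (fun t => g (1 - t)) y x.
Proof.
  intros (H0 & H1 & H). split; [|split].
  - rewrite Rminus_0_r. exact H1.
  - replace (1 - 1) with 0 by ring. exact H0.
  - intros s t Hs Ht. rewrite H by lra. rewrite (dist_sym Y y x).
    replace (1 - s - (1 - t)) with (- (s - t)) by ring. now rewrite Rabs_Ropp.
Qed.

Lemma geodesic_fan (g h : R -> Y) o x y t :
  is_geodesic g o x -> is_geodesic h o y -> 0 <= t <= 1 ->
  dist (g t) (h t) <= t * dist x y.
Proof.
  intros Hg Hh Ht.
  assert (H1 := CAT0_CN Y HY _ _ (h t) g t Hg Ht).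
  assert (H2 := CAT0_CN Y HY _ _ x h t Hh Ht).
  rewrite (dist_sym Y (h t) x), (dist_sym Y (h t) o), (geodesic_dist_l _ _ _ _ _ Hh Ht) in H1.
  rewrite (dist_sym Y x o) in H2. rewrite (dist_sym Y (g t) (h t)).
  assert (Hp := dist_pos Y x y).
  apply (Rmult_le_compat_l t) in H2; [|lra].
  apply Rle_of_sqr; [nra|]. lra.
Qed.

(** Two fans, joined along the diagonal from [x] to [y']. *)
Lemma geodesic_convex (g h : R -> Y) x x' y y' t :
  is_geodesic g x y -> is_geodesic h x' y' -> 0 <= t <= 1 ->
  dist (g t) (h t) <= (1 - t) * dist x x' + t * dist y y'.
Proof.
  intros Hg Hh Ht. destruct (proj1 HY x y') as [k Hk].
  assert (H1 := geodesic_fan g k x y y' t Hg Hk Ht).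
  assert (H2 := geodesic_fan _ _ y' x x' (1 - t) (geodesic_rev _ _ _ Hk)
    (geodesic_rev _ _ _ Hh) ltac:(lra)).
  cbv beta in H2. replace (1 - (1 - t)) with t in H2 by ring.
  assert (H3 := dist_tri Y (g t) (k t) (h t)). lra.
Qed.

End CompleteCAT0.

(** * Asymptotic centres and one-point extensions *)

Record ultrafilter {I : Type} (U : (I -> Prop) -> Prop) : Prop := {
  ultra_mono : forall P Q : I -> Prop, (forall i, P i -> Q i) -> U P -> U Q;
  ultra_and : forall P Q : I -> Prop, U P -> U Q -> U (fun i => P i /\ Q i);
  ultra_ex : forall P : I -> Prop, U P -> exists i, P i;
  ultra_or : forall P : I -> Prop, U P \/ U (fun i => ~ P i)
}.

Lemma ultrafilter_extending {I : Type} (F : (I -> Prop) -> Prop) :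
  F (fun _ => True) ->
  (forall P Q : I -> Prop, (forall i, P i -> Q i) -> F P -> F Q) ->
  (forall P Q : I -> Prop, F P -> F Q -> F (fun i => P i /\ Q i)) ->
  ~ F (fun _ => False) ->
  exists U, ultrafilter U /\ forall P, F P -> U P.
Proof.
  intros HT HS HI H0.
  destruct (@filter.ultraFilterLemma I F) as (U & HU & HFU).
  { constructor; [exact H0|]. constructor; [exact HT|exact HI|exact HS]. }
  exists U. split; [|exact HFU].
  assert (HP := @filter.ultra_proper I U HU).
  assert (HF := @filter.filter_filter I U HP).
  split.
  - intros P Q HPQ. exact (@filter.filterS I U HF P Q HPQ).
  - intros P Q. exact (@filter.filterI I U HF P Q).
  - intros P HUP. apply NNPP. intros Hn.
    apply (@filter.filter_not_empty I U HP).
    apply (@filter.filterS I U HF P); [|exact HUP].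
    intros i Hi. exfalso. apply Hn. now exists i.
  - intros P. exact (@filter.in_ultra_setVsetC I U P HU).
Qed.

Definition ultralimit {I : Type} (U : (I -> Prop) -> Prop) (f : I -> R) (l : R) : Prop :=
  forall eps, 0 < eps -> U (fun i => Rabs (f i - l) < eps).

(** The limit is the supremum of those [t] that [f] exceeds on a member of [U]. *)
Lemma ultralimit_exists {I : Type} (U : (I -> Prop) -> Prop) (f : I -> R) (M : R) :
  ultrafilter U -> (forall i, Rabs (f i) <= M) -> exists l, ultralimit U f l.
Proof.
  intros HU HM.
  assert (HUT : U (fun _ => True)).
  { destruct (ultra_or _ HU (fun _ => True)) as [H|H]; [exact H|].
    destruct (ultra_ex _ HU _ H) as [i Hi]. now elim Hi. }
  destruct (completeness (fun t => U (fun i => t < f i))) as [l [Hl1 Hl2]].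
  - exists M. intros t Ht. destruct (ultra_ex _ HU _ Ht) as [i Hi].
    specialize (HM i). apply Rabs_le_between in HM. lra.
  - exists (- M - 1). apply (ultra_mono _ HU (fun _ => True)); [|exact HUT].
    intros i _. specialize (HM i). apply Rabs_le_between in HM. lra.
  - exists l. intros eps Heps.
    assert (H1 : exists t, l - eps < t /\ U (fun i => t < f i)).
    { apply NNPP. intros Hn. enough (l <= l - eps) by lra. apply Hl2.
      intros t Ht. apply Rnot_lt_le. intros Hlt. apply Hn. now exists t. }
    destruct H1 as (t & Ht & HUt).
    destruct (ultra_or _ HU (fun i => l + eps / 2 < f i)) as [H2|H2].
    { specialize (Hl1 _ H2). lra. }
    apply (ultra_mono _ HU (fun i => t < f i /\ ~ l + eps / 2 < f i)).
    + intros i [Hi1 Hi2]. apply Rabs_lt_between. lra.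
    + now apply (ultra_and _ HU).
Qed.

Section OnePoint.

Context (Y : MetricSpace) (HY : CAT0 Y) (HYc : complete Y).
Context (C : Y -> Prop) (HCc : closed_set C) (HCg : geoconvex C).
Context (o : Y) (Ho : C o) (M : R) (HM : forall x y, C x -> C y -> dist x y <= M).

(** Minimality is recorded in its quadratic form, which is what the comparison of two centres
    uses. *)
Definition ultracenter {I : Type} (U : (I -> Prop) -> Prop) (v : I -> Y) (b : Y) : Prop :=
  C b /\ exists phi : Y -> R,
    (forall y, ultralimit U (fun i => dist y (v i) ^ 2) (phi y)) /\
    forall z, C z -> phi b + dist b z ^ 2 <= phi z.

(** [phi] inherits strong convexity and semicontinuity from the functions [dist y (v i) ^ 2]; the
    latter is uniform in [i] because [dist y (v i)] is at most [dist y o + M]. *)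
Lemma ultracenter_exists {I : Type} (U : (I -> Prop) -> Prop) (v : I -> Y) :
  ultrafilter U -> (forall i, C (v i)) -> exists b, ultracenter U v b.
Proof.
  intros HU Hv.
  assert (Hphi : forall y, exists r, ultralimit U (fun i => dist y (v i) ^ 2) r).
  { intros y. apply (ultralimit_exists U _ ((dist y o + M) ^ 2)); [exact HU|].
    intros i. rewrite Rabs_pos_eq by apply pow2_ge_0. apply pow_incr.
    split; [apply dist_pos|]. eapply Rle_trans; [apply (dist_tri Y y o)|].
    specialize (HM o (v i) Ho (Hv i)). lra. }
  destruct (choice _ Hphi) as [phi Hp].
  destruct (strongly_convex_minimizer Y HY HYc C phi 0) as (b & Hb & Hmin).
  - now exists o.
  - exact HCc.
  - exact HCg.
  - intros x z g t Hg Ht. apply le_epsilon. intros eps Heps.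
    destruct (ultra_ex _ HU _ (ultra_and _ HU _ _ (Hp (g t) (eps / 2) ltac:(lra))
      (ultra_and _ HU _ _ (Hp x (eps / 2) ltac:(lra)) (Hp z (eps / 2) ltac:(lra)))))
      as (i & H1 & H2 & H3).
    apply Rabs_lt_between in H1. apply Rabs_lt_between in H2. apply Rabs_lt_between in H3.
    assert (H := dist_sqr_convex Y HY (v i) x z g t Hg Ht). cbv beta in H.
    rewrite !(dist_sym Y (v i)) in H.
    assert ((1 - t) * (dist x (v i) ^ 2) <= (1 - t) * (phi x + eps / 2))
      by (apply Rmult_le_compat_l; lra).
    assert (t * (dist z (v i) ^ 2) <= t * (phi z + eps / 2))
      by (apply Rmult_le_compat_l; lra).
    lra.
  - intros y eps Heps.
    set (K := dist y o + M).
    assert (HK : 0 <= K).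
    { unfold K. assert (H1 := dist_pos Y y o). assert (H2 := HM o o Ho Ho).
      rewrite dist_refl in H2. lra. }
    exists (eps / (4 * (K + 1))).
    assert (Hd : 0 < eps / (4 * (K + 1))).
    { apply Rmult_lt_0_compat; [lra|apply Rinv_0_lt_compat; lra]. }
    split; [exact Hd|]. intros z Hz.
    assert (HKe : eps / (4 * (K + 1)) * (4 * (K + 1)) = eps) by (field; lra).
    set (e := eps / (4 * (K + 1))) in *.
    destruct (ultra_ex _ HU _ (ultra_and _ HU _ _ (Hp y (eps / 4) ltac:(lra))
      (Hp z (eps / 4) ltac:(lra)))) as (i & H1 & H2).
    apply Rabs_lt_between in H1. apply Rabs_lt_between in H2.
    assert (H3 := dist_tri Y y z (v i)).
    assert (H4 : dist y (v i) <= K).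
    { eapply Rle_trans; [apply (dist_tri Y y o)|].
      specialize (HM o (v i) Ho (Hv i)). unfold K. lra. }
    assert (H5 := dist_pos Y y (v i)). assert (H6 := dist_pos Y z (v i)).
    assert (H7 := dist_pos Y y z).
    assert (H8 : dist y (v i) ^ 2 - dist z (v i) ^ 2 <= 2 * K * e).
    { destruct (Rle_dec (dist y (v i)) (dist z (v i))); nra. }
    nra.
  - intros y _. apply Rnot_lt_le. intros Hlt.
    destruct (ultra_ex _ HU _ (Hp y (- phi y) ltac:(lra))) as (i & H1).
    apply Rabs_lt_between in H1. assert (H := pow2_ge_0 (dist y (v i))). lra.
  - exists b. split; [exact Hb|]. now exists phi.
Qed.

(** Adding the minimalities of [b] and [c] bounds [2 * D ^ 2] by a limit of quadrilateral
    differences, hence by [2 * D] times the distance from [v i] to [w i]. *)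
Lemma ultracenter_dist {I : Type} (U : (I -> Prop) -> Prop) (v w : I -> Y) (b c : Y) (q : R) :
  ultrafilter U -> ultracenter U v b -> ultracenter U w c -> 0 <= q ->
  (forall eta, 0 < eta -> U (fun i => dist (v i) (w i) ^ 2 <= q + eta)) ->
  dist b c ^ 2 <= q.
Proof.
  intros HU (Hb & phi & Hp & Hpm) (Hc & psi & Hs & Hsm) Hq Hvw.
  apply Rnot_lt_le. intros Hlt.
  assert (HD := dist_pos Y b c). set (D := dist b c) in *.
  assert (HD0 : 0 < D) by nra.
  set (r := sqrt (q + (D ^ 2 - q) / 2)).
  assert (Hr : r ^ 2 = q + (D ^ 2 - q) / 2) by (apply pow2_sqrt; lra).
  assert (Hr0 : 0 <= r) by apply sqrt_pos.
  assert (HrD : r < D) by nra.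
  (* Four ultralimits enter, with total error [D * (D - r)], half of the available gap
     [2 * D * (D - r)]. *)
  set (e := D * (D - r) / 4).
  assert (He : 0 < e) by (unfold e; nra).
  destruct (ultra_ex _ HU _ (ultra_and _ HU _ _
    (ultra_and _ HU _ _ (Hp b e He) (Hp c e He))
    (ultra_and _ HU _ _ (ultra_and _ HU _ _ (Hs b e He) (Hs c e He))
      (Hvw ((D ^ 2 - q) / 2) ltac:(lra))))) as (i & (H1 & H2) & (H3 & H4) & H5).
  apply Rabs_lt_between in H1, H2, H3, H4.
  assert (Hq4 := quadrilateral Y HY b c (v i) (w i)).
  specialize (Hpm c Hc). specialize (Hsm b Hb). rewrite (dist_sym Y c b) in Hsm.
  fold D in Hpm, Hsm, Hq4. rewrite <- Hr in H5.
  assert (H6 : dist (v i) (w i) <= r) by (now apply Rle_of_sqr).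
  assert (H7 : D * dist (v i) (w i) <= D * r) by (apply Rmult_le_compat_l; lra).
  unfold e in *. nra.
Qed.

Lemma ultracenter_const {I : Type} (U : (I -> Prop) -> Prop) (v : I -> Y) (b y : Y) :
  ultrafilter U -> ultracenter U v b -> C y -> U (fun i => v i = y) -> b = y.
Proof.
  intros HU Hb Hy HvU.
  assert (Hcy : ultracenter U (fun _ => y) y).
  { split; [exact Hy|]. exists (fun z => dist z y ^ 2). split.
    - intros z eps Heps. apply (ultra_mono _ HU (fun i => v i = y)); [|exact HvU].
      intros i _. now rewrite Rminus_diag, Rabs_R0.
    - intros z _. rewrite dist_refl, (dist_sym Y z y). lra. }
  assert (H : dist b y ^ 2 <= 0).
  { apply (ultracenter_dist U v (fun _ => y)); auto; [lra|].
    intros eta Heta. apply (ultra_mono _ HU (fun i => v i = y)); [|exact HvU].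
    intros i ->. rewrite dist_refl. lra. }
  apply dist_eq0. assert (H1 := dist_pos Y b y). nra.
Qed.


Definition scaled {T : Type} (c : R) (l : list (R * T)) : list (R * T) :=
  map (fun p => (c * fst p, snd p)) l.

Lemma lsum_scaled {T : Type} (c : R) (f : T -> R) (l : list (R * T)) :
  lsum (fun p => fst p * f (snd p)) (scaled c l) = c * lsum (fun p => fst p * f (snd p)) l.
Proof.
  unfold scaled. rewrite lsum_map, <- lsum_scal. apply lsum_ext; intros; simpl; ring.
Qed.

(* For finitely supported weights [l], the value at the barycentre of [l] is at most
   [eta / 2] by the Lang-Schroeder inequality; the barycentre of nearly optimal
   weights satisfies all constraints, since shifting a little weight to the [j]-th
   point cannot increase the value by much. *)
Lemma one_point_extension {T : Type} (J : T -> Prop) (v : T -> Y) (q : T -> R)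
    (Q : T -> T -> R) (eta : R) :
  0 < eta -> (forall j, J j -> C (v j)) -> (forall j, J j -> 0 <= q j) ->
  (forall i j, J i -> J j -> dist (v i) (v j) ^ 2 <= Q i j + eta) ->
  (forall l : list (R * T), (forall p, In p l -> 0 <= fst p /\ J (snd p)) ->
    0 <= dsum (fun p r => fst p * fst r * (q (snd p) + q (snd r) - Q (snd p) (snd r))) l) ->
  exists y, C y /\ forall j, J j -> dist y (v j) ^ 2 <= q j + eta.
Proof.
  intros Heta HvC Hq HvQ HLS.
  destruct (classic (exists j, J j)) as [[j0 Hj0]|HJ].
  2: { exists o. split; [exact Ho|]. intros j Hj. elim HJ. now exists j. }
  set (adm := fun l : list (R * T) =>
    (forall p, In p l -> 0 <= fst p /\ J (snd p)) /\ lsum fst l = 1).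
  set (Phi := fun (l : list (R * T)) z =>
    lsum (fun p => fst p * (dist z (v (snd p)) ^ 2 - q (snd p))) l).
  assert (HM0 : 0 <= M) by (specialize (HM o o Ho Ho); rewrite dist_refl in HM; exact HM).
  assert (Hbary : forall l, adm l ->
    exists b, C b /\ forall z, C z -> Phi l b + dist b z ^ 2 <= Phi l z).
  { intros l [Hl Hl1].
    apply (strongly_convex_minimizer Y HY HYc C (Phi l)
      (lsum (fun p => fst p * - q (snd p)) l)); auto.
    - now exists o.
    - intros x z g t Hg Ht. unfold Phi.
      apply Rle_trans with (lsum (fun p =>
        (1 - t) * (fst p * (dist x (v (snd p)) ^ 2 - q (snd p)))
        + t * (fst p * (dist z (v (snd p)) ^ 2 - q (snd p)))
        - t * (1 - t) * dist x z ^ 2 * fst p) l).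
      + apply lsum_le. intros p Hp. destruct (Hl p Hp) as [Hp0 _].
        assert (H := dist_sqr_convex Y HY (v (snd p)) x z g t Hg Ht). cbv beta in H.
        rewrite !(dist_sym Y (v (snd p))) in H.
        apply (Rmult_le_compat_l (fst p)) in H; [|exact Hp0]. lra.
      + rewrite lsum_minus, lsum_plus, !lsum_scal, Hl1. lra.
    - intros y eps Heps.
      set (K := lsum (fun p => fst p * (2 * dist y (v (snd p)))) l).
      assert (HK : 0 <= K).
      { apply lsum_nonneg. intros p Hp. destruct (Hl p Hp) as [Hp0 _].
        assert (H := dist_pos Y y (v (snd p))). apply Rmult_le_pos; lra. }
      exists (eps / (K + 1)).
      split; [apply Rmult_lt_0_compat; [lra|apply Rinv_0_lt_compat; lra]|].
      intros z Hz.
      assert (He : eps / (K + 1) * (K + 1) = eps) by (field; lra).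
      assert (H : Phi l y - Phi l z <= dist y z * K).
      { unfold Phi, K. rewrite <- lsum_minus, <- lsum_scal. apply lsum_le.
        intros p Hp. destruct (Hl p Hp) as [Hp0 _].
        assert (H1 := dist_tri Y y z (v (snd p))).
        assert (H2 := dist_pos Y y (v (snd p))). assert (H3 := dist_pos Y z (v (snd p))).
        assert (H4 := dist_pos Y y z).
        assert (H5 : dist y (v (snd p)) ^ 2 - dist z (v (snd p)) ^ 2
                  <= dist y z * (2 * dist y (v (snd p)))).
        { destruct (Rle_dec (dist y (v (snd p))) (dist z (v (snd p)))); nra. }
        apply (Rmult_le_compat_l (fst p)) in H5; [|exact Hp0]. lra. }
      assert (dist y z * K <= eps / (K + 1) * K) by (apply Rmult_le_compat_r; lra).
      assert (0 < eps / (K + 1)) by (assert (H1 := dist_pos Y y z); lra). lra.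
    - intros y Hy. apply lsum_le. intros p Hp. destruct (Hl p Hp) as [Hp0 _].
      assert (H := pow2_ge_0 (dist y (v (snd p)))). apply Rmult_le_compat_l; lra. }
  assert (Hbound : forall l b, adm l ->
    (forall z, C z -> Phi l b + dist b z ^ 2 <= Phi l z) -> Phi l b <= eta / 2).
  (* Averaging the minimality of [b] over the points [v j] with the weights of [l] bounds
     [2 * Phi l b] by the double sum of [d ^ 2 - q - q'], which is at most [eta]. The factor 2 is
     the gain that stops the slack from growing. *)
  { intros l b [Hl Hl1] Hb.
    assert (H1 : lsum (fun p => Phi l b * fst p + fst p * dist b (v (snd p)) ^ 2) l
              <= lsum (fun p => fst p * Phi l (v (snd p))) l).
    { apply lsum_le. intros p Hp. destruct (Hl p Hp) as [Hp0 HpJ].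
      specialize (Hb _ (HvC _ HpJ)). apply (Rmult_le_compat_l (fst p)) in Hb; [|exact Hp0].
      lra. }
    rewrite lsum_plus, lsum_scal, Hl1 in H1.
    assert (H2 : lsum (fun p => fst p * dist b (v (snd p)) ^ 2) l
              = Phi l b + lsum (fun p => fst p * q (snd p)) l).
    { unfold Phi. rewrite <- lsum_plus. apply lsum_ext. intros; ring. }
    assert (H3 : lsum (fun p => fst p * Phi l (v (snd p))) l
                 - lsum (fun p => fst p * q (snd p)) l
              = dsum (fun p r => fst p * fst r * (dist (v (snd p)) (v (snd r)) ^ 2
                       - q (snd p) - q (snd r))) l).
    { unfold dsum, Phi. rewrite <- lsum_minus. apply lsum_ext. intros p Hp.
      rewrite <- lsum_scal. rewrite <- (Rmult_1_r (fst p * q (snd p))), <- Hl1.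
      rewrite <- lsum_scal, <- lsum_minus. apply lsum_ext. intros; ring. }
    assert (H4 : dsum (fun p r => fst p * fst r * (dist (v (snd p)) (v (snd r)) ^ 2
                       - q (snd p) - q (snd r))) l
              <= dsum (fun p r => fst p * (eta * fst r)
                   - fst p * fst r * (q (snd p) + q (snd r) - Q (snd p) (snd r))) l).
    { apply dsum_le. intros p r Hp Hr.
      destruct (Hl p Hp) as [Hp0 HpJ]. destruct (Hl r Hr) as [Hr0 HrJ].
      assert (H := HvQ _ _ HpJ HrJ).
      apply (Rmult_le_compat_l (fst p * fst r)) in H; [|now apply Rmult_le_pos]. lra. }
    assert (H5 : dsum (fun p r : R * T => fst p * (eta * fst r)
                   - fst p * fst r * (q (snd p) + q (snd r) - Q (snd p) (snd r))) l
              = eta - dsum (fun p r => fst p * fst r *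
                        (q (snd p) + q (snd r) - Q (snd p) (snd r))) l).
    { apply eq_trans with (lsum (fun p : R * T => eta * fst p) l -
        dsum (fun p r => fst p * fst r * (q (snd p) + q (snd r) - Q (snd p) (snd r))) l);
        [|rewrite lsum_scal, Hl1; ring].
      unfold dsum. rewrite <- lsum_minus. apply lsum_ext. intros p Hp.
      rewrite lsum_minus, !lsum_scal, Hl1. ring. }
    specialize (HLS l Hl). lra. }
  destruct (completeness (fun r => exists l b, adm l /\
      (C b /\ forall z, C z -> Phi l b + dist b z ^ 2 <= Phi l z) /\ r = Phi l b))
    as [G [HG1 HG2]].
  { exists (eta / 2). intros r (l & b & Hl & [_ Hb] & ->). now apply Hbound. }
  { assert (Hl : adm [(1, j0)]).
    { split; [|simpl; ring]. intros p [<-|[]]. simpl. split; [lra|exact Hj0]. }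
    destruct (Hbary _ Hl) as [b Hb]. exists (Phi [(1, j0)] b), [(1, j0)], b. auto. }
  assert (HGe : G <= eta / 2).
  { apply HG2. intros r (l & b & Hl & [_ Hb] & ->). now apply Hbound. }
  (* [k] is the allowed displacement of the barycentre: it costs [2 * M * k <= eta / 6] beyond the
     [eta * (3 / 4)] of [HX]. The weight [t] to be shifted is small enough to enforce it. *)
  set (k := eta / (12 * (M + 1))).
  assert (Hk : k * (12 * (M + 1)) = eta) by (unfold k; field; lra).
  assert (Hk0 : 0 < k) by (apply Rmult_lt_0_compat; [lra|apply Rinv_0_lt_compat; lra]).
  assert (HM2 := pow2_ge_0 M).
  assert (Hk2 : 0 < k ^ 2) by (apply pow_lt; exact Hk0).
  set (t := Rmin (1 / 2) (k ^ 2 / (2 * (eta + M ^ 2 + 1)))).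
  assert (Ht0 : 0 < t).
  { apply Rmin_pos; [lra|]. apply Rmult_lt_0_compat; [lra|apply Rinv_0_lt_compat; lra]. }
  assert (Ht1 : t <= 1 / 2) by apply Rmin_l.
  assert (Ht2 : t * (2 * (eta + M ^ 2 + 1)) <= k ^ 2).
  { apply Rle_trans with (k ^ 2 / (2 * (eta + M ^ 2 + 1)) * (2 * (eta + M ^ 2 + 1))).
    - apply Rmult_le_compat_r; [lra|apply Rmin_r].
    - right. field. lra. }
  assert (Hnear : exists l b, adm l /\
      (C b /\ forall z, C z -> Phi l b + dist b z ^ 2 <= Phi l z) /\
      G - t * eta / 4 < Phi l b).
  { apply NNPP. intros Hn. enough (G <= G - t * eta / 4) by nra. apply HG2.
    intros r (l & b & Hl & Hb & ->). apply Rnot_lt_le. intros Hlt. apply Hn.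
    exists l, b. auto. }
  destruct Hnear as (l & b & Hl & [HbC Hb] & HG).
  exists b. split; [exact HbC|]. intros j Hj.
  assert (Hbj := HM _ _ HbC (HvC j Hj)). assert (Hbj0 := dist_pos Y b (v j)).
  (* [t] is fixed before [j], while [q] may be unbounded on [J]; where [q j] reaches the squared
     diameter bound the constraint is automatic. *)
  destruct (Rle_dec (M ^ 2) (q j)) as [HMq|HMq].
  { assert (dist b (v j) ^ 2 <= M ^ 2) by (apply pow_incr; lra). lra. }
  set (l' := (t, j) :: scaled (1 - t) l).
  assert (Hl' : adm l').
  { destruct Hl as [Hl Hl1]. split.
    - intros p [<-|Hp]; [simpl; split; [lra|exact Hj]|].
      unfold scaled in Hp. apply in_map_iff in Hp. destruct Hp as (p' & <- & Hp').
      destruct (Hl p' Hp') as [H1 H2]. simpl. split; [apply Rmult_le_pos; lra|exact H2].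
    - unfold l'; simpl. unfold scaled. rewrite lsum_map. simpl.
      rewrite lsum_scal, Hl1. ring. }
  assert (HPhi : forall z, Phi l' z = t * (dist z (v j) ^ 2 - q j) + (1 - t) * Phi l z).
  { intros z. unfold Phi, l'. simpl.
    now rewrite (lsum_scaled (1 - t) (fun i => dist z (v i) ^ 2 - q i)). }
  destruct (Hbary l' Hl') as (b' & Hb'C & Hb').
  assert (HG' : Phi l' b' <= G) by (apply HG1; exists l', b'; auto).
  rewrite HPhi in HG'. specialize (Hb b' Hb'C).
  apply (Rmult_le_compat_l (1 - t)) in Hb; [|lra].
  assert (HG'' : (1 - t) * (G - t * eta / 4) <= (1 - t) * Phi l b)
    by (apply Rmult_le_compat_l; lra).
  assert (HD0 := dist_pos Y b b'). set (D := dist b b') in *.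
  assert (Hx0 := pow2_ge_0 (dist b' (v j))).
  assert (HtG : t * G <= t * (eta / 2)) by (apply Rmult_le_compat_l; lra).
  assert (Htq : t * q j <= t * M ^ 2) by (apply Rmult_le_compat_l; lra).
  assert (Hte : t * t * eta >= 0) by nra.
  assert (Htx : 0 <= t * dist b' (v j) ^ 2) by (apply Rmult_le_pos; lra).
  assert (HtD : (1 / 2) * D ^ 2 <= (1 - t) * D ^ 2)
    by (apply Rmult_le_compat_r; [apply pow2_ge_0|lra]).
  assert (HX : dist b' (v j) ^ 2 - q j <= eta * (3 / 4)).
  { apply Rmult_le_reg_l with t; [exact Ht0|].
    assert (0 <= D ^ 2) by apply pow2_ge_0. nra. }
  assert (HDk : D <= k) by (apply Rle_of_sqr; nra).
  assert (Hb'j := HM _ _ Hb'C (HvC j Hj)). assert (Hb'j0 := dist_pos Y b' (v j)).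
  assert (Htri := dist_tri Y b b' (v j)). fold D in Htri.
  assert (dist b (v j) ^ 2 - dist b' (v j) ^ 2 <= 2 * M * k).
  { destruct (Rle_dec (dist b (v j)) (dist b' (v j))); [nra|].
    replace (dist b (v j) ^ 2 - dist b' (v j) ^ 2)
      with ((dist b (v j) - dist b' (v j)) * (dist b (v j) + dist b' (v j))) by ring.
    rewrite (Rmult_comm (2 * M)). apply Rmult_le_compat; lra. }
  nra.
Qed.

(** * From finitely many points to all points *)

Section Extension.

Context {S : Type} (Q : S -> S -> R) (lam : S -> R) (D : S -> Prop) (f : S -> Y).
Context (Q_sym : forall s t, Q s t = Q t s) (Q_pos : forall s t, 0 <= Q s t).
Context (HfC : forall s, D s -> C (f s)).
Context (HfQ : forall s t, D s -> D t -> dist (f s) (f t) ^ 2 <= Q s t).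
Context (HLS : forall s (l : list (R * S)),
  (forall p, In p l -> 0 <= fst p /\ lam (snd p) <= lam s) ->
  0 <= dsum (fun p r => fst p * fst r *
         (Q s (snd p) + Q s (snd r) - Q (snd p) (snd r))) l).
Context (Hbridge : forall s t, D t -> lam s < lam t ->
  exists t', D t' /\ lam t' <= lam s /\ forall y eta, C y -> 0 <= eta ->
    dist y (f t') ^ 2 <= Q s t' + eta -> dist y (f t) ^ 2 <= Q s t + eta).

(** The head has the highest level, so induction from the tail adds points in increasing order. *)
Definition decreasing (l : list S) : Prop := StronglySorted (fun s t => lam t <= lam s) l.

Lemma decreasing_insert (s : S) (l : list S) : decreasing l ->
  exists l', decreasing l' /\ In s l' /\ incl l l' /\ incl l' (s :: l).
Proof.
  induction 1 as [|x l Hl IH Hx].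
  - exists [s]. repeat split; [repeat constructor|now left|intros y []|apply incl_refl].
  - destruct (Rle_dec (lam x) (lam s)) as [Hle|Hgt].
    + exists (s :: x :: l). repeat split.
      * constructor; [now constructor|]. constructor; [exact Hle|].
        apply Forall_impl with (2 := Hx). intros; lra.
      * now left.
      * apply incl_tl, incl_refl.
      * apply incl_refl.
    + destruct IH as (l' & H1 & H2 & H3 & H4). exists (x :: l'). repeat split.
      * constructor; [exact H1|]. apply Forall_forall. intros y Hy.
        rewrite Forall_forall in Hx. destruct (H4 y Hy) as [<-|Hy']; [lra|auto].
      * now right.
      * intros y [<-|Hy]; [now left|right; auto].
      * intros y [<-|Hy]; [right; now left|].
        destruct (H4 y Hy) as [<-|Hy']; [now left|right; now right].
Qed.

Lemma decreasing_cover (T : list S) : exists l, decreasing l /\ incl T l.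
Proof.
  induction T as [|s T (l & Hl & HT)].
  - exists []. split; [constructor|apply incl_refl].
  - destruct (decreasing_insert s l Hl) as (l' & H1 & H2 & H3 & _).
    exists l'. split; [exact H1|]. intros y [<-|Hy]; auto.
Qed.

(* Points are added in order of increasing [lam], because the Lang-Schroeder
   inequality [HLS] at [s] only concerns points of lower level. *)
Lemma finite_extension (eta : R) (l : list S) : 0 < eta -> decreasing l ->
  exists F : S -> Y, (forall s, C (F s)) /\ (forall s, D s -> F s = f s) /\
    forall s t, In s l \/ D s -> In t l \/ D t -> dist (F s) (F t) ^ 2 <= Q s t + eta.
Proof.
  intros Heta. induction 1 as [|s l Hl (F & FC & FD & FQ) Hs].
  - exists (fun s => if excluded_middle_informative (D s) then f s else o).
    split; [|split].
    + intros s. destruct (excluded_middle_informative (D s)); auto.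
    + intros s Hs. destruct (excluded_middle_informative (D s)); [reflexivity|contradiction].
    + intros s t [[]|Hs] [[]|Ht].
      destruct (excluded_middle_informative (D s)); [|contradiction].
      destruct (excluded_middle_informative (D t)); [|contradiction].
      specialize (HfQ s t Hs Ht). lra.
  - destruct (classic (In s l \/ D s)) as [Hin|Hout].
    { exists F. split; [exact FC|]. split; [exact FD|].
      intros a b Ha Hb. apply FQ.
      - destruct Ha as [[<-|Ha]|Ha]; auto.
      - destruct Hb as [[<-|Hb]|Hb]; auto. }
    rewrite Forall_forall in Hs.
    (* All prescribed points of level at most [lam s] enter at once, so the index set of the
       one-point step may be infinite. *)
    destruct (one_point_extension (fun t => (In t l \/ D t) /\ lam t <= lam s) F (Q s) Q eta)
      as (y & Hy & HyJ); auto.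
    { intros i j [Hi _] [Hj _]. auto. }
    { intros l' Hl'. apply HLS. intros p Hp. destruct (Hl' p Hp) as [H1 [_ H2]]. auto. }
    assert (HyQ : forall t, In t l \/ D t -> dist y (F t) ^ 2 <= Q s t + eta).
    { intros t Ht. destruct (Rle_dec (lam t) (lam s)) as [Hle|Hgt]; [auto|].
      destruct Ht as [Ht|Ht]; [now elim Hgt; apply Hs|].
      (* A prescribed point of higher level took no part in the one-point step; its constraint is
         deduced from that of a prescribed point which did. *)
      destruct (Hbridge s t Ht ltac:(lra)) as (t' & Ht' & Hlam & Hb).
      rewrite (FD t Ht). apply Hb; [exact Hy|lra|].
      rewrite <- (FD t' Ht'). apply HyJ. auto. }
    exists (fun t => if excluded_middle_informative (t = s) then y else F t).
    split; [|split].
    + intros t. destruct (excluded_middle_informative (t = s)); auto.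
    + intros t Ht. destruct (excluded_middle_informative (t = s)) as [->|_]; auto.
      elim Hout; auto.
    + intros a b Ha Hb.
      destruct (excluded_middle_informative (a = s)) as [->|Has];
        destruct (excluded_middle_informative (b = s)) as [->|Hbs].
      * rewrite dist_refl. specialize (Q_pos s s). lra.
      * apply HyQ. destruct Hb as [[Hb|Hb]|Hb]; auto. congruence.
      * rewrite dist_sym, Q_sym. apply HyQ. destruct Ha as [[Ha|Ha]|Ha]; auto. congruence.
      * apply FQ.
        -- destruct Ha as [[Ha|Ha]|Ha]; auto. congruence.
        -- destruct Hb as [[Hb|Hb]|Hb]; auto. congruence.
Qed.

(** Finite extensions are indexed by a tolerance and a list. Along an ultrafilter refining this
    directed system, asymptotic centres keep every pairwise bound and lose the slack. *)
Lemma extension : exists F : S -> Y,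
  (forall s, C (F s)) /\ (forall s, D s -> F s = f s) /\
  forall s t, dist (F s) (F t) ^ 2 <= Q s t.
Proof.
  assert (Hfin : forall i : nat * list S, exists F : S -> Y,
   
    (forall s, C (F s)) /\ (decreasing (snd i) ->
      (forall s, D s -> F s = f s) /\
      forall s t, In s (snd i) -> In t (snd i) ->
        dist (F s) (F t) ^ 2 <= Q s t + / (INR (fst i) + 1))).
  { intros [n l]; simpl. destruct (classic (decreasing l)) as [Hl|Hl].
    - destruct (finite_extension (/ (INR n + 1)) l) as (F & FC & FD & FQ); [|exact Hl|].
      + apply Rinv_0_lt_compat. assert (H := pos_INR n). lra.
      + exists F. split; [exact FC|]. intros _. split; [exact FD|]. intros; apply FQ; auto.
    - exists (fun _ : S => o). split; [auto|contradiction]. }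
  destruct (choice (fun (i : nat * list S) (F : S -> Y) =>
    (forall s, C (F s)) /\ (decreasing (snd i) ->
      (forall s, D s -> F s = f s) /\
      forall s t, In s (snd i) -> In t (snd i) ->
        dist (F s) (F t) ^ 2 <= Q s t + / (INR (fst i) + 1))) Hfin) as [F HF].
  (* Only sorted lists count in this filter, so the default chosen for the others is harmless;
     [decreasing_cover] makes it proper. *)
  destruct (ultrafilter_extending (fun P : nat * list S -> Prop =>
      exists N T, forall n l, (N <= n)%nat -> incl T l -> decreasing l -> P (n, l)))
    as (U & HU & HFU).
  { exists 0%nat, []. auto. }
  { intros P P' HPP (N & T & HP). exists N, T. auto. }
  { intros P P' (N & T & HP) (N' & T' & HP'). exists (Nat.max N N'), (T ++ T').
    intros n l Hn HTl Hl. apply incl_app_inv in HTl. destruct HTl.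
    split; [apply HP|apply HP']; auto; lia. }
  { intros (N & T & HP). destruct (decreasing_cover T) as (l & Hl & HTl).
    exact (HP N l (le_n N) HTl Hl). }
  assert (Hcen : forall s, exists b, ultracenter U (fun i => F i s) b).
  { intros s. apply ultracenter_exists; [exact HU|]. intros i. apply HF. }
  destruct (choice _ Hcen) as [G HG]. exists G.
  split; [|split].
  - intros s. apply HG.
  - intros s Hs. apply (ultracenter_const U (fun i => F i s)); auto.
    apply HFU. exists 0%nat, []. intros n l _ _ Hl.
    destruct (HF (n, l)) as [_ HFl]. now apply HFl.
  - intros s t. apply (ultracenter_dist U (fun i => F i s) (fun i => F i t)); auto.
    intros eta Heta. apply HFU. destruct (archimed_cor1 eta Heta) as (N & HN & HN0).
    exists N, [s; t]. intros n l Hn HT Hl.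
    destruct (HF (n, l)) as [_ HFl]. destruct (HFl Hl) as [_ HFQ]. simpl in HFQ.
    eapply Rle_trans; [apply HFQ; apply HT; simpl; auto|].
    apply Rplus_le_compat_l. left. eapply Rle_lt_trans; [|exact HN].
    apply Rinv_le_contravar; [now apply lt_0_INR|]. apply le_INR in Hn. lra.
Qed.

End Extension.

End OnePoint.

(** * Lipschitz constants and the supremum metric *)

(** For each pair [x], [y] the condition on [L] is closed, so the infimum is itself admissible;
    where [dS x y] vanishes, any admissible constant decides. *)
Lemma Lip_spec {S : Type} (dS : S -> S -> R) {Y : MetricSpace} (f : S -> Y) :
  (forall x y, 0 <= dS x y) -> lipschitz dS f ->
  0 <= real (Lip dS f) /\ (forall x y, dist (f x) (f y) <= real (Lip dS f) * dS x y) /\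
  forall L, 0 <= L -> (forall x y, dist (f x) (f y) <= L * dS x y) -> real (Lip dS f) <= L.
Proof.
  intros HdS [L0 HL0].
  set (E := fun L => 0 <= L /\ forall x y, dist (f x) (f y) <= L * dS x y).
  assert (HE : E (Rmax L0 0)).
  { split; [apply Rmax_r|]. intros x y. eapply Rle_trans; [apply HL0|].
    apply Rmult_le_compat_r; [apply HdS|apply Rmax_l]. }
  assert (HG : is_glb_Rbar E (Lip dS f)) by apply Glb_Rbar_correct.
  destruct (Lip dS f) as [l| |]; simpl.
  - destruct HG as [H1 H2]. split; [|split].
    + apply (H2 (Finite 0)). intros L [HL _]. exact HL.
    + intros x y. apply Rnot_lt_le. intros Hlt.
      destruct (HdS x y) as [Hpos|Hz].
      * assert (H3 : dist (f x) (f y) / dS x y <= l).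
        { apply (H2 (Finite (dist (f x) (f y) / dS x y))). intros L [_ HL]. simpl.
          apply Rmult_le_reg_r with (dS x y); [exact Hpos|].
          replace (dist (f x) (f y) / dS x y * dS x y) with (dist (f x) (f y)) by (field; lra).
          apply HL. }
        apply (Rmult_le_compat_r (dS x y)) in H3; [|lra].
        replace (dist (f x) (f y) / dS x y * dS x y) with (dist (f x) (f y)) in H3 by (field; lra).
        lra.
      * destruct HE as [_ HE]. specialize (HE x y). rewrite <- Hz in *. lra.
    + intros L HL HLf. apply (H1 L). now split.
  - destruct HG as [H1 _]. elim (H1 _ HE).
  - destruct HG as [_ H2]. elim (H2 (Finite 0)). intros L [HL _]. exact HL.
Qed.

Section SupDist.

Context {S : Type} (s0 : S) {Y : MetricSpace}.
Implicit Types f g h : S -> Y.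

Lemma supdist_le f g e : (forall s, dist (f s) (g s) <= e) -> supdist f g <= e.
Proof.
  intros H. unfold supdist.
  assert (HL := Lub_Rbar_correct (fun r => exists x, r = dist (f x) (g x))).
  destruct (Lub_Rbar _) as [l| |]; simpl; destruct HL as [H1 H2].
  - apply (H2 (Finite e)). intros r [s ->]. apply H.
  - elim (H2 (Finite e)). intros r [s ->]. apply H.
  - elim (H1 (dist (f s0) (g s0))). now exists s0.
Qed.

Lemma le_supdist f g s : bounded_map f -> bounded_map g -> dist (f s) (g s) <= supdist f g.
Proof.
  intros [M HM] [M' HM']. unfold supdist.
  assert (HL := Lub_Rbar_correct (fun r => exists x, r = dist (f x) (g x))).
  destruct (Lub_Rbar _) as [l| |]; simpl; destruct HL as [H1 H2].
  - apply (H1 (dist (f s) (g s))). now exists s.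
  - elim (H2 (Finite (M + dist (f s0) (g s0) + M'))). intros r [x ->]. simpl.
    assert (T1 := dist_tri Y (f x) (f s0) (g x)).
    assert (T2 := dist_tri Y (f s0) (g s0) (g x)).
    specialize (HM x s0). specialize (HM' s0 x). lra.
  - elim (H1 (dist (f s0) (g s0))). now exists s0.
Qed.

Lemma supdist_refl f : supdist f f = 0.
Proof.
  apply Rle_antisym.
  - apply supdist_le. intros s. rewrite dist_refl. lra.
  - unfold supdist.
    assert (HL := Lub_Rbar_correct (fun r => exists x, r = dist (f x) (f x))).
    destruct (Lub_Rbar _) as [l| |]; simpl; [|lra|lra].
    destruct HL as [H1 _]. apply (H1 0). exists s0. now rewrite dist_refl.
Qed.

Lemma supdist_sym f g : supdist f g = supdist g f.
Proof.
  unfold supdist. f_equal. apply Lub_Rbar_eqset. intros r.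
  split; intros [x ->]; exists x; apply dist_sym.
Qed.

Lemma supdist_pos f g : bounded_map f -> bounded_map g -> 0 <= supdist f g.
Proof.
  intros Hf Hg. eapply Rle_trans; [apply (dist_pos Y (f s0) (g s0))|now apply le_supdist].
Qed.

Lemma supdist_tri f g h : bounded_map f -> bounded_map g -> bounded_map h ->
  supdist f h <= supdist f g + supdist g h.
Proof.
  intros Hf Hg Hh. apply supdist_le. intros s.
  eapply Rle_trans; [apply (dist_tri Y _ (g s))|].
  apply Rplus_le_compat; now apply le_supdist.
Qed.

Lemma bounded_const (o : Y) : bounded_map (fun _ : S => o).
Proof. exists 0. intros. rewrite dist_refl. lra. Qed.

End SupDist.

Lemma ball_closed (Y : MetricSpace) (o : Y) (N : R) : closed_set (fun y => dist o y <= N).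
Proof.
  intros p Hp. apply le_epsilon. intros eps Heps. destruct (Hp eps Heps) as (q & Hq & Hpq).
  assert (H := dist_tri Y o q p). rewrite (dist_sym Y q p) in H. lra.
Qed.

Lemma ball_geoconvex (Y : MetricSpace) (HY : CAT0 Y) (o : Y) (N : R) :
  geoconvex (fun y => dist o y <= N).
Proof.
  intros x z g t Hx Hz Hg Ht. assert (H := CAT0_CN Y HY x z o g t Hg Ht).
  assert (Hx0 := dist_pos Y o x). assert (Hz0 := dist_pos Y o z).
  assert (H1 : dist o x ^ 2 <= N ^ 2) by (apply pow_incr; lra).
  assert (H2 : dist o z ^ 2 <= N ^ 2) by (apply pow_incr; lra).
  assert (H3 := pow2_ge_0 (dist x z)).
  apply Rle_of_sqr; [lra|].
  assert (0 <= t * (1 - t) * dist x z ^ 2) by (apply Rmult_le_pos; [nra|exact H3]).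
  assert ((1 - t) * dist o x ^ 2 <= (1 - t) * N ^ 2) by (apply Rmult_le_compat_l; lra).
  assert (t * dist o z ^ 2 <= t * N ^ 2) by (apply Rmult_le_compat_l; lra).
  lra.
Qed.

(** In the square of [dist p q + e] the cross term is at most [4 * N * e] and [e ^ 2] at most
    [2 * N * e], whence the 6. *)
Lemma dist_perturbation (Y : MetricSpace) (p q r : Y) (N e : R) :
  dist p q <= 2 * N -> dist q r <= e -> e <= 2 * N ->
  dist p r ^ 2 <= dist p q ^ 2 + 6 * N * e.
Proof.
  intros H1 H2 H3. assert (H4 := dist_tri Y p q r).
  assert (P1 := dist_pos Y p q). assert (P2 := dist_pos Y q r). assert (P3 := dist_pos Y p r).
  assert (dist p r ^ 2 <= (dist p q + e) ^ 2) by (apply pow_incr; lra).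
  assert (dist p q * e <= 2 * N * e) by (apply Rmult_le_compat_r; lra).
  assert (e * e <= 2 * N * e) by (apply Rmult_le_compat_r; lra).
  lra.
Qed.

(** * Simultaneous extension of bounded Lipschitz maps *)

Section Extensions.

Context (X Y : MetricSpace) (A : X -> Prop).
Context (HX : CBB0 X) (HY : CAT0 Y) (HYc : complete Y) (a0 : sub A) (o : Y).

Definition lam (g : sub A -> Y) : R := real (Lip (sub_dist A) g).

Lemma lam_spec (g : sub A -> Y) : inL A g ->
  0 <= lam g /\ (forall a b, dist (g a) (g b) <= lam g * dist (proj1_sig a) (proj1_sig b)) /\
  forall L, 0 <= L ->
    (forall a b, dist (g a) (g b) <= L * dist (proj1_sig a) (proj1_sig b)) -> lam g <= L.
Proof.
  intros [_ Hg]. apply (Lip_spec (sub_dist A) g); [|exact Hg].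
  intros a b. apply dist_pos.
Qed.

(** Elements of [sub A] carry a proof; a Lipschitz map cannot see it, since the two elements are at
    distance 0. *)
Lemma inL_ext (g : sub A -> Y) x (H H' : A x) : inL A g -> g (exist A x H) = g (exist A x H').
Proof.
  intros Hg. apply dist_eq0. destruct (lam_spec g Hg) as (_ & H1 & _).
  specialize (H1 (exist A x H) (exist A x H')). simpl in H1.
  rewrite dist_refl, Rmult_0_r in H1.
  assert (H2 := dist_pos Y (g (exist A x H)) (g (exist A x H'))). lra.
Qed.

Definition radius (g : sub A -> Y) : R := supdist g (fun _ => o).

Lemma radius_spec (g : sub A -> Y) a : inL A g -> dist o (g a) <= radius g.
Proof.
  intros [Hg _]. rewrite dist_sym.
  apply (le_supdist a g (fun _ => o)); [exact Hg|apply bounded_const].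
Qed.

Lemma radius_pos (g : sub A -> Y) : inL A g -> 0 <= radius g.
Proof. intros [Hg _]. apply (supdist_pos a0); [exact Hg|apply bounded_const]. Qed.

Lemma radius_dist (g h : sub A -> Y) : inL A g -> inL A h -> radius h <= radius g + supdist g h.
Proof.
  intros [Hg _] [Hh _]. rewrite (supdist_sym g h). unfold radius.
  assert (H := supdist_tri a0 h g (fun _ => o) Hh Hg (bounded_const o)). lra.
Qed.

(* [6 * N * e] absorbs the change from [g] to [h] of a value in the ball of radius [N]
   (see [dist_perturbation]); being a metric in [(g, h)], it preserves the
   Lang-Schroeder inequality termwise. *)
Lemma level_extension (N : R) : 0 <= N ->
  exists F : (sub A -> Y) -> X -> Y, forall g, inL A g -> radius g <= N ->
    (forall x, dist o (F g x) <= N) /\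
    (forall a, F g (proj1_sig a) = g a) /\
    (forall x y, dist (F g x) (F g y) <= lam g * dist x y) /\
    forall h, inL A h -> radius h <= N ->
      forall x, dist (F g x) (F h x) ^ 2 <= 6 * N * supdist g h.
Proof.
  intros HN.
  set (P := fun g => inL A g /\ radius g <= N).
  set (c := fun s : sig P * X => lam (proj1_sig (fst s)) ^ 2).
  set (e := fun s t : sig P * X => supdist (proj1_sig (fst s)) (proj1_sig (fst t))).
  set (d2 := fun s t : sig P * X => dist (snd s) (snd t) ^ 2).
  set (Q := fun s t => Rmin (c s) (c t) * d2 s t + 6 * N * e s t).
  set (f := fun s : sig P * X => match excluded_middle_informative (A (snd s)) with
              | left H => proj1_sig (fst s) (exist A _ H) | right _ => o end).
  assert (Hf : forall s (H : A (snd s)), f s = proj1_sig (fst s) (exist A _ H)).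
  { intros [[g [Hg Hr]] x] H. unfold f; simpl in *.
    destruct (excluded_middle_informative (A x)) as [H'|]; [now apply inL_ext|contradiction]. }
  assert (Hc : forall s, 0 <= c s) by (intros; apply pow2_ge_0).
  assert (Hd2 : forall s t, 0 <= d2 s t) by (intros; apply pow2_ge_0).
  assert (Hd2s : forall s t, d2 s t = d2 t s) by (intros; unfold d2; now rewrite dist_sym).
  assert (Hb : forall s : sig P * X, bounded_map (proj1_sig (fst s))).
  { intros [[g [Hg Hr]] x]. exact (proj1 Hg). }
  assert (He : forall s t, 0 <= e s t) by (intros; now apply (supdist_pos a0)).
  assert (Hes : forall s t, e s t = e t s) by (intros; apply supdist_sym).
  assert (Het : forall s t u, e t u <= e s t + e s u).
  { intros s t u. rewrite (Hes s t). now apply (supdist_tri a0). }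
  assert (HeN : forall s t, e s t <= 2 * N).
  { intros s t. unfold e. eapply Rle_trans;
      [apply (supdist_tri a0 _ (fun _ => o)); auto; apply bounded_const|].
    rewrite (supdist_sym (fun _ => o)).
    destruct s as [[g [Hg Hr]] x]. destruct t as [[h [Hh Hr']] y]. simpl.
    unfold radius in *. lra. }
  assert (HfC : forall s, A (snd s) -> dist o (f s) <= N).
  { intros [[g [Hg Hr]] x] H. rewrite (Hf _ H). simpl.
    eapply Rle_trans; [now apply radius_spec|exact Hr]. }
  assert (Hdiam : forall x y, dist o x <= N -> dist o y <= N -> dist x y <= 2 * N).
  { intros x y Hx Hy. assert (T := dist_tri Y x o y). rewrite (dist_sym Y x o) in T. lra. }
  assert (Hfc : forall s t, fst s = fst t -> A (snd s) -> A (snd t) ->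
            dist (f s) (f t) ^ 2 <= c s * d2 s t).
  { intros s t Hst Hs Ht. rewrite (Hf s Hs), (Hf t Ht), <- Hst. unfold c, d2.
    destruct (lam_spec (proj1_sig (fst s)) (proj1 (proj2_sig (fst s)))) as (_ & H & _).
    specialize (H (exist A _ Hs) (exist A _ Ht)). simpl in H.
    rewrite <- Rpow_mult_distr. apply pow_incr. split; [apply dist_pos|exact H]. }
  assert (Hfe : forall s t, snd s = snd t -> A (snd s) -> dist (f s) (f t) <= e s t).
  { intros s t Hst Hs. assert (Ht := Hs). rewrite Hst in Ht.
    rewrite (Hf s Hs), (Hf t Ht). unfold e.
    destruct s as [g x], t as [h y]. simpl in *. subst y.
    rewrite (inL_ext (proj1_sig h) x Ht Hs) by (exact (proj1 (proj2_sig h))).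
    apply (le_supdist a0); [apply (Hb (g, x))|apply (Hb (h, x))]. }
  (* Exchanging the map of [t] for that of [s] at the same point of [A] costs only the perturbation
     term. Compatibility of [f] with [Q] and the bridge both rest on this. *)
  assert (Hbr : forall s t y, A (snd t) -> dist o y <= N ->
            dist y (f t) ^ 2 <= dist y (f (fst s, snd t)) ^ 2 + 6 * N * e s t).
  { intros s t y Ht Hy. apply dist_perturbation; [|apply (Hfe (fst s, snd t) t)|apply HeN]; auto. }
  destruct (extension Y HY HYc (fun y => dist o y <= N) (ball_closed Y o N)
    (ball_geoconvex Y HY o N) o ltac:(cbv beta; rewrite dist_refl; exact HN) (2 * N) Hdiam
    Q c (fun s => A (snd s)) f) as (F & FC & FD & FQ).
  - intros s t. unfold Q. now rewrite Rmin_comm, Hd2s, Hes.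
  - intros s t. unfold Q. apply Rplus_le_le_0_compat.
    + apply Rmult_le_pos; [now apply Rmin_glb|apply Hd2].
    + apply Rmult_le_pos; [lra|apply He].
  - exact HfC.
  - assert (Hle : forall s t, A (snd s) -> A (snd t) -> c s <= c t ->
              dist (f s) (f t) ^ 2 <= Q s t).
    { intros s t Hs Ht Hst. unfold Q. rewrite Rmin_left by exact Hst.
      eapply Rle_trans; [apply (Hbr s t); auto|].
      apply Rplus_le_compat_r. now apply (Hfc s (fst s, snd t)). }
    intros s t Hs Ht. destruct (Rle_dec (c s) (c t)) as [H|H]; [now apply Hle|].
    rewrite dist_sym. unfold Q. rewrite Rmin_comm, Hd2s, Hes. apply Hle; auto. lra.
  - intros s l Hl.
    (* As [s] has the highest level, its minima reduce to the levels of the other points; the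
       supremum terms contribute nonnegatively by the triangle inequality. *)
    apply Rle_trans with (dsum (fun q r => fst q * fst r *
      (c (snd q) * d2 s (snd q) + c (snd r) * d2 s (snd r)
       - Rmin (c (snd q)) (c (snd r)) * d2 (snd q) (snd r))) l).
    + apply (lang_schroeder_min (d2 s) c d2); auto.
      * intros l' Hl'.
        assert (H := lang_schroeder X HX (snd s) (map (fun q => (fst q, snd (snd q))) l')).
        rewrite dsum_map in H. apply H. intros q Hq. apply in_map_iff in Hq.
        destruct Hq as (q' & <- & Hq'). now apply Hl'.
      * intros q Hq. now apply Hl.
    + apply dsum_le. intros q r Hq Hr. destruct (Hl q Hq) as [Hq0 Hqc].
      destruct (Hl r Hr) as [Hr0 Hrc]. apply Rmult_le_compat_l; [now apply Rmult_le_pos|].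
      unfold Q. rewrite (Rmin_right (c s) (c (snd q))), (Rmin_right (c s) (c (snd r))) by assumption.
      assert (6 * N * e (snd q) (snd r) <= 6 * N * (e s (snd q) + e s (snd r)))
        by (apply Rmult_le_compat_l; [lra|apply Het]). lra.
  (* The map of [s] at the point of [t]: the level is that of [s], and the supremum term
     vanishes. *)
  - intros s t Ht Hst. exists (fst s, snd t). simpl. split; [exact Ht|].
    split; [unfold c; simpl; lra|]. intros y eta Hy Heta H.
    eapply Rle_trans; [now apply (Hbr s t)|].
    unfold Q in *. rewrite (Rmin_left (c s) (c t)) by lra.
    rewrite (Rmin_left (c s) (c (fst s, snd t))) in H by (unfold c; simpl; lra).
    assert (He0 : e s (fst s, snd t) = 0) by (apply (supdist_refl a0)).
    rewrite He0 in H. unfold d2 in *. simpl in *. lra.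
  - exists (fun g x => match excluded_middle_informative (P g) with
              | left H => F (exist P g H, x) | right _ => o end).
    intros g Hg Hr.
    destruct (excluded_middle_informative (P g)) as [HP|HP]; [|elim HP; now split].
    split; [|split; [|split]].
    + intros x. apply FC.
    + intros [x Hx]. simpl. rewrite (FD (exist P g HP, x) Hx), (Hf (exist P g HP, x) Hx). reflexivity.
    + intros x y. assert (H := FQ (exist P g HP, x) (exist P g HP, y)).
      unfold Q, c, e, d2 in H. simpl fst in H. simpl snd in H. simpl proj1_sig in H.
      rewrite (supdist_refl a0), Rmin_left in H by lra.
      apply Rle_of_sqr.
      * apply Rmult_le_pos; [now apply lam_spec|apply dist_pos].
      * rewrite Rpow_mult_distr. lra.
    + intros h Hh Hr' x.
      destruct (excluded_middle_informative (P h)) as [HP'|HP']; [|elim HP'; now split].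
      assert (H := FQ (exist P g HP, x) (exist P h HP', x)).
      unfold Q, c, e, d2 in H. simpl fst in H. simpl snd in H. simpl proj1_sig in H.
      rewrite dist_refl in H. lra.
Qed.

(** * Closed convex hulls and their dependence on the map *)

Lemma image_clco {S : Type} (g : S -> Y) (s : S) : clco (image g) (g s).
Proof.
  intros eps Heps. exists (g s). split; [|rewrite dist_refl; exact Heps].
  exists 1%nat. split; [lia|]. destruct (proj1 HY (g s) (g s)) as [k Hk].
  exists (g s), (g s), k, 0. repeat split; try lra; try apply Hk; try now exists s.
  symmetry. apply Hk.
Qed.

Lemma closure_closed (C : Y -> Prop) : closed_set (closure C).
Proof.
  intros p Hp eps Heps. destruct (Hp (eps / 2) ltac:(lra)) as (q & Hq & Hpq).
  destruct (Hq (eps / 2) ltac:(lra)) as (r & Hr & Hqr). exists r. split; [exact Hr|].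
  assert (H := dist_tri Y p q r). lra.
Qed.

Lemma Gn_mono (C : Y -> Prop) (n m : nat) (p : Y) : (n <= m)%nat -> Gn n C p -> Gn m C p.
Proof.
  intros Hnm Hp. induction Hnm as [|m Hnm IH]; [exact Hp|].
  destruct (proj1 HY p p) as [k Hk]. exists p, p, k, 0.
  split; [exact IH|]. split; [exact IH|]. split; [exact Hk|]. split; [lra|].
  symmetry. apply Hk.
Qed.

Lemma clco_geoconvex (C : Y -> Prop) : geoconvex (clco C).
Proof.
  intros x z g t Hx Hz Hg Ht eps Heps.
  destruct (Hx (eps / 2) ltac:(lra)) as (x' & (n & Hn & Hx') & Hxx').
  destruct (Hz (eps / 2) ltac:(lra)) as (z' & (m & Hm & Hz') & Hzz').
  destruct (proj1 HY x' z') as [k Hk]. exists (k t). split.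
  - exists (Datatypes.S (Nat.max n m)). split; [lia|].
    exists x', z', k, t. split; [apply (Gn_mono C n); [lia|exact Hx']|].
    split; [apply (Gn_mono C m); [lia|exact Hz']|]. auto.
  - assert (H := geodesic_convex Y HY g k x x' z z' t Hg Hk Ht).
    assert ((1 - t) * dist x x' <= (1 - t) * (eps / 2)) by (apply Rmult_le_compat_l; lra).
    assert (t * dist z z' <= t * (eps / 2)) by (apply Rmult_le_compat_l; lra). lra.
Qed.

(** Convexity of the metric carries the bound through every geodesic stage. The gap between [e] and
    [e'] leaves room for the closure. *)
Lemma clco_near {S : Type} (g h : S -> Y) (e e' : R) (p : Y) :
  (forall s, dist (g s) (h s) <= e) -> e < e' -> clco (image g) p ->
  exists q, clco (image h) q /\ dist p q <= e'.
Proof.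
  intros Hgh Hee' Hp.
  assert (HGn : forall n x, Gn n (image g) x -> exists y, Gn n (image h) y /\ dist x y <= e).
  { induction n as [|n IH].
    - intros x [s ->]. exists (h s). split; [now exists s|apply Hgh].
    - intros x (x1 & x2 & k & t & H1 & H2 & Hk & Ht & ->).
      destruct (IH _ H1) as (y1 & Hy1 & Hd1). destruct (IH _ H2) as (y2 & Hy2 & Hd2).
      destruct (proj1 HY y1 y2) as [k' Hk']. exists (k' t). split.
      + exists y1, y2, k', t. auto.
      + assert (H := geodesic_convex Y HY k k' x1 y1 x2 y2 t Hk Hk' Ht).
        assert ((1 - t) * dist x1 y1 <= (1 - t) * e) by (apply Rmult_le_compat_l; lra).
        assert (t * dist x2 y2 <= t * e) by (apply Rmult_le_compat_l; lra). lra. }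
  destruct (Hp (e' - e) ltac:(lra)) as (x & (n & Hn & Hx) & Hpx).
  destruct (HGn n x Hx) as (y & Hy & Hxy). exists y. split.
  - intros eps Heps. exists y. split; [now exists n|rewrite dist_refl; exact Heps].
  - assert (H := dist_tri Y p x y). lra.
Qed.

(* Gluing the extensions of the levels [k + 2] and [k + 3] for [radius g] in [k, k + 1)
   yields a map that is continuous in [g] without any bound on [radius g]. *)
Lemma bounded_extension :
  exists H : (sub A -> Y) -> X -> Y, forall g, inL A g ->
    (forall x, dist o (H g x) <= radius g + 3) /\
    (forall a, H g (proj1_sig a) = g a) /\
    (forall x y, dist (H g x) (H g y) <= lam g * dist x y) /\
    forall h s, inL A h -> 0 <= s <= 1 -> supdist g h <= s ^ 2 ->
      forall x, dist (H g x) (H h x) <= 8 * (radius g + 4) * s.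
Proof.
  destruct (choice _ (fun k => level_extension (INR k) (pos_INR k))) as [F HF].
  assert (Hgeo : forall p : Y * Y, exists g, is_geodesic g (fst p) (snd p))
    by (intros p; apply (proj1 HY)).
  destruct (choice _ Hgeo) as [geo' Hgeo']. set (geo := fun p q => geo' (p, q)).
  assert (HG : forall p q, is_geodesic (geo p q) p q) by (intros p q; apply (Hgeo' (p, q))).
  clear Hgeo Hgeo'.
  assert (Hfl : forall r : R, exists n : nat, 0 <= r -> INR n <= r < INR n + 1).
  { intros r. destruct (Rle_dec 0 r) as [Hr|Hr].
    - destruct (nfloor_ex r Hr) as [n Hn]. exists n. intros _. exact Hn.
    - exists 0%nat. intros. contradiction. }
  destruct (choice _ Hfl) as [fl Hfl']. clear Hfl.
  (* The parameter [r] is separated from [g] so that the two can vary in turn. Levels start at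
     [fl r + 2] so that, for [r = radius g], they still admit every [h] with [supdist g h <= 1]. *)
  set (B := fun r g x => geo (F (fl r + 2)%nat g x) (F (fl r + 3)%nat g x) (r - INR (fl r))).
  assert (HI : forall n k, INR (n + k) = INR n + INR k) by apply plus_INR.
  assert (I2 : INR 2 = 2) by (simpl; ring). assert (I3 : INR 3 = 3) by (simpl; ring).
  assert (Hrad : forall g r, inL A g -> 0 <= r -> radius g <= r + 1 ->
            radius g <= INR (fl r + 2) /\ radius g <= INR (fl r + 3)).
  { intros g r Hg Hr Hgr. specialize (Hfl' r Hr). rewrite !HI, I2, I3. lra. }
  assert (HBr : forall g r s, inL A g -> 0 <= r -> radius g <= r + 1 -> r <= s <= r + 1 ->
            forall x, dist (B r g x) (B s g x) <= 2 * (s + 3) * (s - r)).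
  { intros g r s Hg Hr Hgr Hrs x.
    assert (Hball : forall p q, dist o p <= s + 3 -> dist o q <= s + 3 ->
              dist p q <= 2 * (s + 3)).
    { intros p q Hp Hq. assert (T := dist_tri Y p o q). rewrite (dist_sym Y p o) in T. lra. }
    assert (Hr' := Hfl' r Hr). assert (Hs' := Hfl' s ltac:(lra)).
    assert (HFb : forall k, INR k <= s + 3 -> radius g <= INR k -> dist o (F k g x) <= s + 3).
    { intros k Hk Hgk. destruct (HF k g Hg Hgk) as [H _]. specialize (H x). lra. }
    destruct (Hrad g r Hg Hr Hgr) as [R2 R3].
    assert (Hfs : fl s = fl r \/ fl s = (fl r + 1)%nat).
    { assert (fl r <= fl s)%nat.
      { apply Nat.lt_succ_r, INR_lt. rewrite S_INR. lra. }
      assert (fl s <= fl r + 1)%nat.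
      { apply Nat.lt_succ_r, INR_lt. rewrite S_INR, HI. simpl INR. lra. }
      lia. }
    unfold B. destruct Hfs as [E|E]; rewrite E in *.
    - destruct (HG (F (fl r + 2)%nat g x) (F (fl r + 3)%nat g x)) as (_ & _ & H).
      rewrite H by lra. rewrite Rabs_left1 by lra. rewrite Rmult_comm.
      replace (- (r - INR (fl r) - (s - INR (fl r)))) with (s - r) by ring.
      apply Rmult_le_compat_r; [lra|]. apply Hball; apply HFb; rewrite ?HI, ?I2, ?I3 in *; lra.
    (* Across an integer the two geodesics share the endpoint [q]. *)
    - replace (fl r + 1 + 2)%nat with (fl r + 3)%nat by lia.
      replace (fl r + 1 + 3)%nat with (fl r + 4)%nat by lia.
      rewrite HI in Hs' |- *. change (INR 1) with 1 in *.
      assert (I4 : INR 4 = 4) by (simpl; ring).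
      set (p := F (fl r + 2)%nat g x). set (q := F (fl r + 3)%nat g x).
      set (u := F (fl r + 4)%nat g x).
      assert (Hpq : dist p q <= 2 * (s + 3))
        by (apply Hball; apply HFb; rewrite ?HI, ?I2, ?I3 in *; lra).
      assert (Hqu : dist q u <= 2 * (s + 3))
        by (apply Hball; apply HFb; rewrite ?HI, ?I2, ?I3, ?I4 in *; lra).
      assert (H1 := geodesic_dist_r Y _ _ _ (r - INR (fl r)) (HG p q) ltac:(lra)).
      assert (H2 := geodesic_dist_l Y _ _ _ (s - (INR (fl r) + 1)) (HG q u) ltac:(lra)).
      eapply Rle_trans; [apply (dist_tri Y _ q)|]. rewrite H1, H2.
      assert ((1 - (r - INR (fl r))) * dist p q <= (1 - (r - INR (fl r))) * (2 * (s + 3)))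
        by (apply Rmult_le_compat_l; lra).
      assert ((s - (INR (fl r) + 1)) * dist q u <= (s - (INR (fl r) + 1)) * (2 * (s + 3)))
        by (apply Rmult_le_compat_l; lra).
      lra. }
  exists (fun g => B (radius g) g). intros g Hg.
  assert (Hg0 := radius_pos g Hg). assert (Hfg := Hfl' _ Hg0).
  destruct (Hrad g (radius g) Hg Hg0 ltac:(lra)) as [R2 R3].
  destruct (HF _ g Hg R2) as (A2 & E2 & L2 & C2).
  destruct (HF _ g Hg R3) as (A3 & E3 & L3 & C3).
  split; [|split; [|split]].
  - intros x.
    apply (ball_geoconvex Y HY o (radius g + 3) _ _ _ (radius g - INR (fl (radius g)))
      ) with (3 := HG _ _); [| |lra].
    + eapply Rle_trans; [apply A2|]. rewrite HI, I2. lra.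
    + eapply Rle_trans; [apply A3|]. rewrite HI, I3. lra.
  - intros a. unfold B. rewrite E2, E3. apply dist_eq0. rewrite dist_sym.
    rewrite (geodesic_dist_l Y _ _ _ _ (HG (g a) (g a))) by lra. rewrite dist_refl. ring.
  - intros x y. unfold B. set (t := radius g - INR (fl (radius g))).
    assert (Ht : 0 <= t <= 1) by (unfold t; lra).
    eapply Rle_trans; [apply (geodesic_convex Y HY _ _ _ _ _ _ t (HG _ _) (HG _ _) Ht)|].
    specialize (L2 x y). specialize (L3 x y).
    apply (Rmult_le_compat_l (1 - t)) in L2; [|lra].
    apply (Rmult_le_compat_l t) in L3; [|lra]. lra.
  - intros h s Hh Hs Hgh x.
    assert (Hs1 : s ^ 2 <= s) by nra.
    assert (Hh0 := radius_pos h Hh).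
    assert (D1 := radius_dist g h Hg Hh). assert (D2 := radius_dist h g Hh Hg).
    rewrite (supdist_sym h g) in D2.
    destruct (Hrad h (radius g) Hh Hg0 ltac:(lra)) as [S2 S3].
    specialize (C2 h Hh S2 x). specialize (C3 h Hh S3 x).
    (* Square roots are taken through [6 * INR k <= (6 * (radius g + 4)) ^ 2]. This 6, for changing
       the map, and the 2 of [T2], for changing the radius, add up to 8. *)
    assert (Hsq : forall (k : nat) (p q : Y), INR k <= radius g + 3 ->
              dist p q ^ 2 <= 6 * INR k * supdist g h -> dist p q <= 6 * (radius g + 4) * s).
    { intros k p q Hk H. apply Rle_of_sqr; [apply Rmult_le_pos; lra|].
      assert (Hk0 := pos_INR k).
      assert (K1 : 6 * INR k * supdist g h <= 6 * INR k * s ^ 2)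
        by (apply Rmult_le_compat_l; lra).
      assert (Hss := pow2_ge_0 s).
      assert (K2 : 6 * INR k * s ^ 2 <= (6 * (radius g + 4)) ^ 2 * s ^ 2)
        by (apply Rmult_le_compat_r; [exact Hss|nra]).
      rewrite Rpow_mult_distr. lra. }
    apply Hsq in C2; [|rewrite HI, I2; lra]. apply Hsq in C3; [|rewrite HI, I3; lra].
    set (t := radius g - INR (fl (radius g))).
    assert (Ht : 0 <= t <= 1) by (unfold t; lra).
    assert (T1 : dist (B (radius g) g x) (B (radius g) h x) <= 6 * (radius g + 4) * s).
    { unfold B. fold t.
      eapply Rle_trans; [apply (geodesic_convex Y HY _ _ _ _ _ _ t (HG _ _) (HG _ _) Ht)|].
      apply (Rmult_le_compat_l (1 - t)) in C2; [|lra].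
      apply (Rmult_le_compat_l t) in C3; [|lra]. lra. }
    assert (T2 : dist (B (radius g) h x) (B (radius h) h x) <= 2 * (radius g + 4) * s).
    { destruct (Rle_dec (radius g) (radius h)) as [Hle|Hlt].
      - eapply Rle_trans; [apply HBr; auto; lra|].
        apply Rmult_le_compat; lra.
      - rewrite dist_sym. eapply Rle_trans; [apply HBr; auto; lra|].
        apply Rmult_le_compat; lra. }
    eapply Rle_trans; [apply (dist_tri Y _ (B (radius g) h x))|]. lra.
Qed.

(** The point [q'] of [C'] near [p] gives [dist y p' <= dist y p + e], so the point [q] of [C] near
    [p'] is within [dist y p + 2 * e] of [y]. Minimality of [p] then forces
    [dist p q ^ 2 <= 4 * e * (r + e)]. *)
Lemma projection_perturbation (C C' : Y -> Prop) (y p p' : Y) (e r : R) :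
  C p -> (forall z, C z -> dist y p ^ 2 + dist p z ^ 2 <= dist y z ^ 2) ->
  C' p' -> (forall z, C' z -> dist y p' ^ 2 + dist p' z ^ 2 <= dist y z ^ 2) ->
  (forall z, C z -> exists z', C' z' /\ dist z z' <= e) ->
  (forall z, C' z -> exists z', C z' /\ dist z z' <= e) ->
  0 <= e -> 0 <= r -> dist y p <= r -> (dist p p' - e) ^ 2 <= 4 * e * (r + e) \/ dist p p' <= e.
Proof.
  intros Hp Hpm Hp' Hpm' HCC' HC'C He Hr Hyp.
  destruct (HC'C p' Hp') as (q & Hq & Hp'q). destruct (HCC' p Hp) as (q' & Hq' & Hpq').
  specialize (Hpm q Hq). specialize (Hpm' q' Hq').
  destruct (Rle_dec (dist p p') e) as [H|H]; [now right|left].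
  assert (T1 := dist_tri Y y p' q). assert (T2 := dist_tri Y y p q').
  assert (T3 := dist_tri Y p q p'). rewrite (dist_sym Y q p') in T3.
  assert (P1 := dist_pos Y y p). assert (P2 := dist_pos Y y p'). assert (P3 := dist_pos Y y q).
  assert (P4 := dist_pos Y y q'). assert (P5 := pow2_ge_0 (dist p' q')).
  assert (H1 : dist y p' <= dist y q') by (apply Rle_of_sqr; lra).
  assert (H2 : dist y q ^ 2 <= (dist y p + 2 * e) ^ 2) by (apply pow_incr; lra).
  assert (H3 : (dist p p' - e) ^ 2 <= dist p q ^ 2) by (apply pow_incr; lra).
  assert (H4 : e * dist y p <= e * r) by (apply Rmult_le_compat_l; lra).
  lra.
Qed.

Lemma retracted_extension :
  exists beta : (sub A -> Y) -> X -> Y, forall g, inL A g ->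
    (forall a, beta g (proj1_sig a) = g a) /\
    (forall x y, dist (beta g x) (beta g y) <= lam g * dist x y) /\
    (forall x, clco (image g) (beta g x)) /\
    (exists M, forall x y, dist (beta g x) (beta g y) <= M) /\
    exists W, 0 < W /\ forall h s, inL A h -> 0 < s <= 1 -> supdist g h < s ^ 2 ->
      forall x, dist (beta g x) (beta h x) <= W * s.
Proof.
  destruct bounded_extension as [H HH].
  assert (HP : forall g : sub A -> Y, exists P : Y -> Y, forall x, clco (image g) (P x) /\
    forall z, clco (image g) z -> dist x (P x) ^ 2 + dist (P x) z ^ 2 <= dist x z ^ 2).
  { intros g. apply projection_exists; auto.
    - exists (g a0). apply image_clco.
    - apply closure_closed.
    - apply clco_geoconvex. }
  destruct (choice _ HP) as [P HP']. clear HP.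
  exists (fun g x => P g (H g x)). intros g Hg.
  destruct (HH g Hg) as (Hb & He & Hl & Hc).
  assert (Hne := projection_nonexpansive Y HY _ (P g) (HP' g)).
  split; [|split; [|split; [|split]]].
  - intros a. rewrite He. destruct (HP' g (g a)) as [_ Hm].
    specialize (Hm (g a) (image_clco g a)). rewrite dist_refl in Hm.
    apply dist_eq0. assert (H1 := dist_pos Y (P g (g a)) (g a)).
    assert (H2 := pow2_ge_0 (dist (g a) (P g (g a)))). nra.
  - intros x y. eapply Rle_trans; [apply Hne|apply Hl].
  - intros x. apply HP'.
  - exists (2 * (radius g + 3)). intros x y. eapply Rle_trans; [apply Hne|].
    assert (T := dist_tri Y (H g x) o (H g y)). rewrite (dist_sym Y (H g x) o) in T.
    assert (H1 := Hb x). assert (H2 := Hb y). lra.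
  - assert (Hg0 := radius_pos g Hg).
    (* Two moves: the argument changes from [H g x] to [H h x], at cost 8, then the hull changes at
       a fixed argument, at cost 12. *)
    exists (20 * (radius g + 4)). split; [lra|]. intros h s Hh Hs Hgh x.
    assert (Hs1 : s ^ 2 <= s) by nra. assert (Hs0 := pow2_ge_0 s).
    set (y := H h x).
    assert (T1 : dist (P g (H g x)) (P g y) <= 8 * (radius g + 4) * s).
    { eapply Rle_trans; [apply Hne|]. apply Hc; auto; lra. }
    destruct (HH h Hh) as (Hbh & _).
    assert (Hh0 := radius_dist g h Hg Hh).
    destruct (HP' g y) as [Hp Hpm]. destruct (HP' h y) as [Hp' Hpm'].
    assert (Hyg : dist y (P g y) <= 2 * radius g + 4).
    { apply Rle_trans with (dist y (g a0)).
      - apply Rle_of_sqr; [apply dist_pos|]. specialize (Hpm _ (image_clco g a0)).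
        assert (H1 := pow2_ge_0 (dist (P g y) (g a0))). lra.
      - eapply Rle_trans; [apply (dist_tri Y y o)|]. rewrite (dist_sym Y y o).
        assert (H1 := Hbh x). fold y in H1. assert (H2 := radius_spec g a0 Hg). lra. }
    assert (Hpt : forall a, dist (g a) (h a) <= supdist g h)
      by (intros a; apply (le_supdist a0); [apply Hg|apply Hh]).
    assert (T2 : dist (P g y) (P h y) <= 12 * (radius g + 4) * s).
    { assert (Hss : s ^ 2 <= 1) by lra.
      destruct (projection_perturbation (clco (image g)) (clco (image h)) y (P g y) (P h y)
        (s ^ 2) (2 * radius g + 4) Hp Hpm Hp' Hpm') as [K|K]; try lra.
      - intros z Hz. now apply (clco_near g h (supdist g h)).
      - intros z Hz. apply (clco_near h g (supdist g h)); auto.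
        intros a. rewrite dist_sym. apply Hpt.
      - assert (K1 : dist (P g y) (P h y) - s ^ 2 <= 8 * (radius g + 4) * s).
        { apply Rle_of_sqr; [apply Rmult_le_pos; lra|].
          rewrite (Rpow_mult_distr _ s).
          assert (s ^ 2 * (4 * (2 * radius g + 4 + s ^ 2)) <= s ^ 2 * (8 * (radius g + 4)) ^ 2)
            by (apply Rmult_le_compat_l; [exact Hs0|nra]). lra. }
        assert (4 * s <= 4 * (radius g + 4) * s) by nra. lra.
      - assert (s <= 12 * (radius g + 4) * s) by nra. lra. }
    eapply Rle_trans; [apply (dist_tri Y _ (P g y))|]. fold y. lra.
Qed.

End Extensions.

Theorem theorem4p5 (X Y : MetricSpace) (A : X -> Prop) :
  CBB0 X -> CAT0 Y -> complete Y -> (exists a, A a) ->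
  exists beta : (sub A -> Y) -> (X -> Y),
    (* beta maps L(A,Y) into L(X,Y) *)
    (forall g, inL A g -> inLX (beta g)) /\
    (* beta is continuous for the supremum metrics *)
    (forall g, inL A g -> forall eps, 0 < eps -> exists delta, 0 < delta /\
       forall h, inL A h -> supdist g h < delta ->
         supdist (beta g) (beta h) < eps) /\
    (forall g, inL A g ->
       (forall a : sub A, beta g (proj1_sig a) = g a) /\
       Lip (@Defs.dist X) (beta g) = Lip (sub_dist A) g /\
       (forall x : X, clco (image g) (beta g x))).
Proof.
  intros HX HY HYc [a Ha]. set (a0 := exist A a Ha : sub A).
  (* The base point [o] is a value of some admissible map. Constant maps are admissible, so none
     exists only if [Y] is empty, and then every clause is vacuous. *)
  destruct (classic (exists g : sub A -> Y, inL A g)) as [[g0 _]|Hno].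
  2: { exists (fun g _ => g a0).
       repeat split; intros; elim Hno; eauto. }
  destruct (retracted_extension X Y A HX HY HYc a0 (g0 a0)) as [beta Hbeta].
  exists beta. split; [|split].
  - intros g Hg. destruct (Hbeta g Hg) as (_ & Hl & _ & Hb & _).
    split; [exact Hb|]. exists (lam X Y A g). exact Hl.
  - intros g Hg eps Heps. destruct (Hbeta g Hg) as (_ & _ & _ & _ & W & HW & HWs).
    set (s := Rmin 1 (eps / (2 * W))).
    assert (Hs0 : 0 < s).
    { apply Rmin_pos; [lra|]. apply Rmult_lt_0_compat; [lra|apply Rinv_0_lt_compat; lra]. }
    assert (Hs1 : s <= 1) by apply Rmin_l.
    assert (Hs2 : W * s <= eps / 2).
    { replace (eps / 2) with (W * (eps / (2 * W))) by (field; lra).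
      apply Rmult_le_compat_l; [lra|apply Rmin_r]. }
    exists (s ^ 2). split; [now apply pow_lt|]. intros h Hh Hgh.
    apply Rle_lt_trans with (W * s); [|lra].
    apply (supdist_le a). intros x. apply HWs; auto.
  - intros g Hg. destruct (Hbeta g Hg) as (Hext & Hl & Hcl & _ & _).
    split; [exact Hext|]. split; [|exact Hcl].
    (* The two sets of constants coincide: one for [beta g] restricts to [A], and one for [g] is at
       least [lam g], which serves for [beta g]. *)
    apply Glb_Rbar_eqset. intros L. split; intros [HL HLip]; (split; [exact HL|]).
    + intros b c. rewrite <- !Hext. apply HLip.
    + intros x y. eapply Rle_trans; [apply Hl|].
      apply Rmult_le_compat_r; [apply dist_pos|]. now apply (lam_spec X Y A g Hg).
Qed.
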